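(* Let $h=(h_i)_{i\ge 0}$ be a probability distribution on $\{0,1,2,\dots\}$ with $\sum_{k\ge 1} k h_k<1$, and suppose that there exists $a>0$ such that $\sum_{l\ge k} h_l\le \exp\{-ak\}$ for each $k\in\mathbb{N}$. Let $\nu$ be a probability distribution (the edge-weight law) with compact support in $(1,\infty)$. Then there exists a constant $c>0$ such that, for all $u>0$ and all integers $i\ge 0$, $$\mathbb{P}_{h,\nu,u}\big(|V(J_i)|\ge k\big)\le \exp\{-ck\}\qquad\text{for each } k\in\mathbb{N},$$ where $J_i$ is the $i$-th outgrowth of $T$, and $J_i=\emptyset$ if $i>D(T)$.
   Context: Trees: let $\mathcal{U}=\bigcup_{n\ge 0}\mathbb{N}^n$ with $\mathbb{N}=\{1,2,\dots\}$ and $\mathbb{N}^0=\{\emptyset\}$. A finite rooted ordered tree $T$ is a finite subset of $\mathcal{U}$ that contains $\emptyset$ (the root, denoted $\phi$), contains $u_1\dots u_{n-1}$ (the parent) whenever it contains $u_1\dots u_n$ with $n\ge1$, and is such that each $u\in T$ has an integer $k_u\ge 0$ with $uj\in T$ if and only if $1\le j\le k_u$. Edges join each non-root vertex to its parent. The tree is weighted if each edge $e$ carries a bias $\beta_e>1$. For $v\in V(T)$, $\omega(v)$ is the product of the biases along the simple path from $\phi$ to $v$ (so $\omega(\phi)=1$), and $\omega(T)=\sum_{v\in V(T)}\omega(v)$. The depth $D(T)$ is the maximal distance from $\phi$ of a vertex of $T$, and $v_{\rm base}$ is the lexicographically minimal vertex among those at distance $D(T)$ from $\phi$. Outgrowths: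 write the vertices of the simple path $P_{\phi,v_{\rm base}}$ from $\phi$ to $v_{\rm base}$ in order as $\phi=\psi_0,\psi_1,\dots,\psi_{D(T)}=v_{\rm base}$. For $0\le i\le D(T)$, the $i$-th outgrowth $J_i$ is the connected component containing $\psi_i$ of the graph with vertex set $V(T)$ and edge set $E(T)\setminus E(P_{\phi,v_{\rm base}})$. Laws: $\mathbb{P}_{h,\nu}$ is the law of a Galton-Watson tree with offspring distribution $h$, with edge biases that, given the tree, are i.i.d. with law $\nu$. For $u>0$, $\mathbb{P}_{h,\nu,u}=\mathbb{P}_{h,\nu}(\,\cdot\mid\omega(T)>u)$.
   Formalization: The bound proved is C exp{-ck} with c, C > 0 depending only on h and ν: exp{-ck} alone fails, since J_0 always contains the root, so for i = 0, k = 1, u < 1 the probability is 1; where ω(T) > u has probability zero the claim is void. *)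

(* Defs.v *)
From HB Require Import structures.
From mathcomp Require Import all_boot all_order all_algebra.
From mathcomp Require Import finmap.
From mathcomp Require Import all_classical all_reals all_analysis.

Set Implicit Arguments.
Unset Strict Implicit.
Unset Printing Implicit Defensive.

Import Order.TTheory GRing.Theory Num.Theory.
Import numFieldNormedType.Exports.

Local Open Scope classical_set_scope.
Local Open Scope ring_scope.

(* A vertex u_1 ... u_n of the Ulam-Harris tree is the sequence [:: u_1; ...; u_n];
   the root is [::] and the parent of [rcons u j] is [u].  Positivity of the
   entries is enforced by the third clause. *)
Definition is_tree (t : {fset seq nat}) : Prop :=
  [/\ [::] \in t,
      forall u j, rcons u j \in t -> u \in t
    & forall u, u \in t ->
        exists k : nat, forall j, (rcons u j \in t) = (1 <= j <= k)%N].

Record rtree := RTree { tree_fset :> {fset seq nat}; _ : `[< is_tree tree_fset >] }.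

HB.instance Definition _ := [isSub for tree_fset].
HB.instance Definition _ := [Countable of rtree by <:].

Definition parent (v : seq nat) : seq nat := take (size v).-1 v.

Section Trees.
Implicit Type t : rtree.

Definition nchildren t (u : seq nat) : nat :=
  #|` [fset v in tree_fset t | (v != [::]) && (parent v == u)]%fset |.

(* The edge joining v to its parent is represented by v. *)
Definition edges t : {fset seq nat} := (tree_fset t `\ [::])%fset.

Definition depth t : nat := (\max_(v : tree_fset t) size (val v))%N.

(* seqlexi nat is seq nat with the lexicographic order; the default value [::]
   is never used, since some vertex has maximal depth. *)
Definition vbase t : seq nat :=
  odflt [::] (omap val
    [pick v : tree_fset t | (size (val v) == depth t) &&
       [forall w : tree_fset t, (size (val w) == depth t) ==>
          ((val v : seqlexi nat) <= (val w : seqlexi nat))%O]]).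

Definition spine t (i : nat) : seq nat := take i (vbase t).

Definition spine_edge t (v : seq nat) : bool :=
  [exists i : 'I_(depth t).+1, (0 < i)%N && (v == spine t i)].

(* Adjacency in the graph (V(T), E(T) minus the edges of the spine). *)
Definition outgrowth_adj t : rel (tree_fset t) := fun v w =>
  [|| [&& val w \in edges t, parent (val w) == val v & ~~ spine_edge t (val w)]
    | [&& val v \in edges t, parent (val v) == val w & ~~ spine_edge t (val v)]].

Definition outgrowth t (i : nat) : {fset seq nat} :=
  if (i <= depth t)%N then
    [fset val v | v : tree_fset t &
       [exists r : tree_fset t,
          (val r == spine t i) && connect (@outgrowth_adj t) r v]]%fset
  else fset0.

End Trees.

Section WeightedTrees.
Variable R : realType.

(* Biases are listed in the order in which [edges wt_tree] is enumerated. *)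
Record wtree := WTree {
  wt_tree : rtree;
  wt_bias : (#|` edges wt_tree|).-tuple (measurableTypeR R) }.

Implicit Type T : wtree.

Definition bias T (e : seq nat) : R :=
  nth 1 (wt_bias T : seq R) (index e (edges (wt_tree T))).

Definition vweight T (v : seq nat) : R :=
  \prod_(1 <= j < (size v).+1) bias T (take j v).

Definition tweight T : R := \sum_(v <- tree_fset (wt_tree T)) vweight T v.

End WeightedTrees.

Section RootTree.

Fact root_treeP : `[< is_tree [fset [::]]%fset >].
Proof.
apply/asboolP; split.
- by rewrite inE.
- by move=> u j; rewrite inE -size_eq0 size_rcons.
- move=> u; rewrite inE => /eqP ->; exists 0%N => j.
  by rewrite inE -size_eq0 size_rcons; case: j.
Qed.

Definition root_tree : rtree := RTree root_treeP.

End RootTree.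

Arguments WTree : clear implicits.

Section WeightedTreeMeasurable.
Variable R : realType.

HB.instance Definition _ := gen_eqMixin (wtree R).
HB.instance Definition _ := gen_choiceMixin (wtree R).
HB.instance Definition _ := isPointed.Build (wtree R)
  (WTree R root_tree [tuple of nseq _ (1 : measurableTypeR R)]).

Definition measurable_wtree (A : set (wtree R)) : Prop :=
  forall t : rtree, measurable (WTree R t @^-1` A).

Let measurable_wtree0 : measurable_wtree set0.
Proof. by move=> t; rewrite preimage_set0; exact: measurable0. Qed.

Let measurable_wtreeC A : measurable_wtree A -> measurable_wtree (~` A).
Proof. by move=> mA t; rewrite preimage_setC; apply: measurableC; exact: mA. Qed.

Let measurable_wtreeU (F : (set (wtree R))^nat) :
  (forall i, measurable_wtree (F i)) -> measurable_wtree (\bigcup_i F i).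
Proof.
move=> mF t; rewrite preimage_bigcup.
by apply: bigcupT_measurable => i; exact: mF.
Qed.

HB.instance Definition _ := @isMeasurable.Build default_measure_display
  (wtree R) measurable_wtree measurable_wtree0 measurable_wtreeC
  measurable_wtreeU.

Lemma measurable_WTree t : measurable_fun setT (WTree R t).
Proof. by move=> _ A mA; rewrite setTI; exact: mA. Qed.

HB.instance Definition _ t :=
  isMeasurableFun.Build _ _ _ _ (WTree R t) (@measurable_WTree t).

End WeightedTreeMeasurable.

Section IID.
Local Open Scope ereal_scope.
Variables (R : realType) (nu : probability (measurableTypeR R) R).

Definition tcons n (x : measurableTypeR R * n.-tuple (measurableTypeR R)) :
  n.+1.-tuple (measurableTypeR R) := [tuple of x.1 :: x.2].

Lemma measurable_tcons n : measurable_fun setT (@tcons n).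
Proof. exact: (measurable_cons measurable_fst measurable_snd). Qed.

HB.instance Definition _ n :=
  isMeasurableFun.Build _ _ _ _ (@tcons n) (@measurable_tcons n).

Fixpoint iid n : probability (n.-tuple (measurableTypeR R)) R :=
  match n with
  | 0 => \d_ [tuple]
  | n.+1 => distribution (nu \x iid n : probability _ R) (@tcons n)
  end.

End IID.

Section Laws.
Local Open Scope ereal_scope.
Variables (R : realType) (h : probability nat R).
Variable nu : probability (measurableTypeR R) R.

(* The probability that a Galton-Watson tree with offspring law h equals t. *)
Definition gw_mass (t : rtree) : R :=
  (\prod_(u <- tree_fset t) fine (h [set nchildren t u]))%R.

(* P_{h,nu} on finite weighted trees: the tree is t with probability gw_mass t,
   and given the tree the biases are i.i.d. with law nu.  Infinite trees are
   disregarded; they have probability 0 when the offspring mean is < 1. *)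
Definition gw_law (A : set (wtree R)) : \bar R :=
  \esum_(t in [set: rtree]) (gw_mass t)%:E * iid nu _ (WTree R t @^-1` A).

Let gw_mass_ge0 t : (0 <= gw_mass t)%R.
Proof. by apply: prodr_ge0 => u _; exact: fine_ge0. Qed.

Let gw_law0 : gw_law set0 = 0.
Proof. by apply: esum1 => t _; rewrite preimage_set0 measure0 mule0. Qed.

Let gw_law_ge0 A : 0 <= gw_law A.
Proof. by apply: esum_ge0 => t _; rewrite mule_ge0 ?lee_fin. Qed.

Let gw_law_sigma_additive : semi_sigma_additive gw_law.
Proof.
move=> F mF tF mUF.
rewrite [X in _ --> X](_ : _ = \sum_(n <oo) gw_law (F n)).
  exact: is_cvg_nneseries.
have F0 t n : 0 <= (gw_mass t)%:E * iid nu _ (WTree R t @^-1` (F n)).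
  by rewrite mule_ge0 ?lee_fin.
rewrite nneseries_esumT // /gw_law.
transitivity (\esum_(t in [set: rtree]) \esum_(n in [set: nat])
    (gw_mass t)%:E * iid nu _ (WTree R t @^-1` (F n))).
  apply: eq_esum => t _; rewrite preimage_bigcup.
  rewrite measure_semi_bigcup //; last 3 first.
  - by move=> n; exact: mF.
  - apply/trivIsetP => i j _ _ ij; rewrite -preimage_setI.
    by move/trivIsetP : tF => /(_ i j I I ij) ->; rewrite preimage_set0.
  - by rewrite -preimage_bigcup; exact: mUF.
  by rewrite -nneseries_esumT // nneseriesZl.
rewrite !esum_esum //.
rewrite (reindex_esum ([set: nat] `*`` (fun=> [set: rtree]))
  ([set: rtree] `*`` (fun=> [set: nat])) (fun x => (x.2, x.1))) //.
split => //.
- by move=> [n t] [m s] _ _ [-> ->].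
- by move=> [t n] _; exists (n, t).
Qed.

HB.instance Definition _ := isMeasure.Build _ _ _ gw_law
  gw_law0 gw_law_ge0 gw_law_sigma_additive.

(* P_{h,nu,u}; the quotient is 0 / 0 = 0 when the conditioning event is null,
   which for nu compactly supported in (1,oo) and offspring mean < 1 happens
   only if h_0 = 1 and 1 <= u. *)
Definition gw_cond (u : R) (A : set (wtree R)) : \bar R :=
  gw_law (A `&` [set T | (u < tweight T)%R]) / gw_law [set T | (u < tweight T)%R].

End Laws.

Definition msupport (R : realType) (nu : probability (measurableTypeR R) R) :
  set R := [set x | forall U : set R, open U -> U x -> (0 < nu U)%E].

(* Main.v *)
Require Import Defs.
From HB Require Import structures.
From mathcomp Require Import all_boot all_order all_algebra.
From mathcomp Require Import finmap.
From mathcomp Require Import all_classical all_reals all_analysis.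
From mathcomp Require Import zify ring lra.

Import Order.TTheory GRing.Theory Num.Theory.
Import numFieldNormedType.Exports.

Local Open Scope classical_set_scope.
Local Open Scope ring_scope.

(** Write P(t) for the Galton-Watson mass of a tree t and f_t(u) for the
    probability that its weight exceeds u, given t.  The claim is that
    sum_{t : |J_i(t)| >= k} P(t) f_t(u) is at most C e^{-ck} sum_t P(t) f_t(u).
    It is proved by cutting the outgrowth J_i off and by paying separately for
    the weight and for the probability of what is removed.

    Let n = |J_i(t)|, and let S be the tree obtained from t by replacing
    everything that hangs below psi_i, except the subtree of psi_(i+1), by g
    leaves.  Here g.+1 is a fixed number of children of positive probability,
    so that S is again a possible Galton-Watson tree.

    - Weight: f_t(u) <= n f_S(u/n) ([le_tree_tail_prune]).  If the weight of t
      exceeds u, then either the weight of t without J_i (psi_i excepted)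
      exceeds u/n, or one of the n - 1 removed vertices v has
      omega(v) > u/n.  The law of omega(v) depends on the distance |v| to the
      root only, and |v| is at most the depth of t, so v can be traded for the
      vertex of the spine at the same height, which is kept.  A heavy
      outgrowth is thus never dearer than a heavy spine, no matter how
      unequal the biases are.

    - Probability: the sum of P(t) over the trees t with |J_i(t)| = n that are
      pruned to S is at most K e^{-cn} P(S) ([esum_prune]).  The removed
      subtrees are independent Galton-Watson trees, whose total progeny has an
      exponential moment ([esum_card_moment]).  That S determines psi_i comes
      from the base vertex being the leftmost deepest one: the child of the
      root through which the spine goes can be read off the depths of the
      subtrees at the root, and pruning preserves these depths.  The proof is
      therefore an induction on i, with no need to locate psi_i in S.

    - Both steps together leave n e^{-cn} sum_S P(S) f_S(u/n).  To return from
      u/n to u, plant a tree on a new root, along an edge of bias at least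
      rho > 1: this multiplies the weight by at least rho at the price of a
      constant factor of probability.  Repeated about log n times it costs a
      factor polynomial in n, and e^{eta n} for every eta > 0 is already
      enough ([gw_tail_div_subexp]).  Summation over n >= k concludes. *)

Set Implicit Arguments.
Unset Strict Implicit.
Unset Printing Implicit Defensive.

(** * The i.i.d. product measure and its marginals *)

Definition box (T : Type) n (B : 'I_n -> set T) : set (n.-tuple T) :=
  [set x | forall i, B i (tnth x i)].

Section Boxes.
Context d (T : measurableType d).

Lemma measurable_box n (B : 'I_n -> set T) :
  (forall i, measurable (B i)) -> measurable (box B).
Proof.
move=> mB; rewrite (_ : box B = \bigcap_(i in [set: 'I_n]) (@tnth n T ^~ i @^-1` (B i))).
  apply: fin_bigcap_measurable => // i _.
  by rewrite -[X in measurable X]setTI; apply: measurable_tnth.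
by apply/seteqP; split=> x /= xB i; [move=> _|]; apply: xB.
Qed.

(** Boxes form a pi-system, which is what identifies a measure on tuples with
    [iid]. *)
Lemma tuple_measurable_box n :
  @measurable _ (n.-tuple T) =
  <<s [set A | exists2 B : 'I_n -> set T, forall i, measurable (B i) & A = box B] >>.
Proof.
apply/seteqP; split => A.
- apply: smallest_sub; first exact: smallest_sigma_algebra.
  rewrite -bigcup_seq => X [i _ [Y mY <-]].
  apply: sub_sigma_algebra.
  exists (fun j => if j == i then Y else setT).
    by move=> j; case: ifP.
  rewrite setTI; apply/seteqP; split=> x /=.
    by move=> Yx j; case: eqP => [->|].
  by move=> /(_ i); rewrite eqxx.
- apply: smallest_sub; first exact: sigma_algebra_measurable.
  by move=> _ [B mB ->]; exact: measurable_box.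
Qed.

End Boxes.

Section Marginals.
Local Open Scope ereal_scope.
Variables (R : realType) (nu : probability (measurableTypeR R) R).

Lemma iid_box n (B : 'I_n -> set (measurableTypeR R)) :
  (forall i, measurable (B i)) -> iid nu n (box B) = \prod_(i < n) nu (B i).
Proof.
elim: n B => [|n IH] B mB.
  rewrite big_ord0 /= diracE mem_set //.
  by case.
rewrite big_ord_recl -IH // -product_measure1E //; last exact: measurable_box.
rewrite /= /pushforward; congr (_ _).
apply/seteqP; split=> -[x y] /=.
  move=> Bxy; split; first by have := Bxy ord0; rewrite tnth0.
  by move=> i; have := Bxy (lift ord0 i); rewrite tnthS.
move=> [B0 By] i; case: (unliftP ord0 i) => [j ->|->]; last by rewrite tnth0.
by rewrite tnthS; exact: By.
Qed.

Definition pick_coord (T : Type) m n (f : 'I_m -> 'I_n) (x : n.-tuple T) : m.-tuple T :=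
  [tuple tnth x (f i) | i < m].

Lemma measurable_pick_coord m n (f : 'I_m -> 'I_n) :
  measurable_fun setT (@pick_coord (measurableTypeR R) m n f).
Proof.
apply/measurable_fun_tnthP => i.
rewrite (_ : _ \o _ = (@tnth _ _)^~ (f i)); first exact: measurable_tnth.
by apply/funext => x /=; rewrite tnth_mktuple.
Qed.

HB.instance Definition _ m n f :=
  isMeasurableFun.Build _ _ _ _ (@pick_coord _ m n f) (@measurable_pick_coord m n f).

(** The only fact about [iid] that is used for trees: the order in which the
    edges of a tree are listed, and the presence of other edges, do not affect
    the joint law of given biases. *)
Lemma iid_marginal m n (f : 'I_m -> 'I_n) (A : set (m.-tuple (measurableTypeR R))) :
  injective f -> measurable A -> iid nu n (pick_coord f @^-1` A) = iid nu m A.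
Proof.
move=> finj mA.
have mbox (k : nat) (B : 'I_k -> set (measurableTypeR R)) := @measurable_box _ (measurableTypeR R) k B.
apply: (measure_unique
  [set A | exists2 B : 'I_m -> set (measurableTypeR R), forall i, measurable (B i) & A = box B]
  (fun=> setT) _ _ _ _ (distribution (iid nu n) (pick_coord f)) (iid nu m)) => //.
- exact: tuple_measurable_box.
- move=> _ _ [B mB ->] [C mC ->]; exists (fun i => B i `&` C i).
    by move=> i; exact: measurableI.
  apply/seteqP; split=> x /=; first by move=> [xB xC] i; split.
  by move=> xBC; split=> i; have [] := xBC i.
- move=> _; exists (fun=> setT) => //.
  by apply/seteqP; split.
- by rewrite bigcup_const //; exists 0%N.
- move=> _ [B mB ->].
  rewrite /= /distribution /pushforward /= iid_box //.
  (* the box of B pulled back: coordinates outside the image of f are free *)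
  pose C j := if [pick i | f i == j] is Some i then B i else setT.
  rewrite (_ : _ @^-1` _ = box C); last first.
    apply/seteqP; split=> x /= xB.
      by move=> j; rewrite /C; case: pickP => // i /eqP <-; have := xB i; rewrite tnth_mktuple.
    move=> i; rewrite tnth_mktuple; have := xB (f i); rewrite /C.
    by case: pickP => [k /eqP/finj ->//|/(_ i)]; rewrite eqxx.
  rewrite iid_box; last by move=> j; rewrite /C; case: pickP.
  rewrite (bigID (mem (codom f))) /= [X in _ * X]big1 ?mule1; last first.
    move=> j jf; rewrite /C; case: pickP => [i /eqP ij|_]; last exact: probability_setT.
    by rewrite -ij codom_f in jf.
  rewrite (reindex_omap f (fun j => [pick i | f i == j])) => [|j /codomP[i ->]].
    apply: eq_big => [i|i _]; rewrite ?codom_f /C /=.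
      by case: pickP => [k /eqP/finj ->|/(_ i)]; rewrite eqxx.
    by case: pickP => [k /eqP/finj ->|/(_ i)] //; rewrite eqxx.
  by case: pickP => [k /eqP/finj ->|/(_ i)] //; rewrite eqxx.
- by move=> _; rewrite /= /distribution /pushforward preimage_setT probability_setT ltry.
Qed.

Lemma iid_cons n (B : set (measurableTypeR R)) (A : set (n.-tuple (measurableTypeR R))) :
  measurable B -> measurable A ->
  iid nu n.+1 [set x | B (thead x) /\ A [tuple of behead x]] = nu B * iid nu n A.
Proof.
move=> mB mA; rewrite -product_measure1E //= /pushforward; congr (_ _).
apply/seteqP; split=> -[x y] /= []; rewrite theadE => Bx Ay; split => //.
  by move: Ay; congr A; apply: val_inj.
by move: Ay; congr A; apply: val_inj.
Qed.

(** Events about the biases of distinct edges of a tree have a probability that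
    does not depend on the tree; this lets two trees be compared through the
    edges that they share. *)
Lemma iid_bias m (t : rtree) (E : m.-tuple (seq nat)) (A : set (m.-tuple (measurableTypeR R))) :
  uniq E -> {subset E <= edges t} -> measurable A ->
  iid nu _ [set b | A [tuple bias (WTree R t b) (tnth E i) | i < m]] = iid nu m A.
Proof.
move=> uE sE mA.
have lt_f i : (index (tnth E i) (edges t) < #|` edges t|)%N.
  by rewrite index_mem; apply: sE; rewrite mem_tnth.
pose f i := Ordinal (lt_f i).
have finj : injective f.
  move=> i j /(congr1 val)/=; rewrite /bias => eqij.
  apply/(tuple_uniqP _ uE).
  have := nth_index [::] (sE _ (mem_tnth i E)).
  by rewrite eqij nth_index ?sE ?mem_tnth.
rewrite -(iid_marginal finj mA); congr (_ _); apply/seteqP; split=> b /=;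
  congr A; apply: eq_from_tnth => i; rewrite !tnth_mktuple /bias /=;
  by rewrite (tnth_nth 1%R).
Qed.

Lemma measurable_bias t e :
  measurable_fun setT (fun b : #|` edges t|.-tuple (measurableTypeR R) => bias (WTree R t b) e).
Proof.
rewrite /bias /=; have [le|lt] := leqP #|` edges t| (index e (edges t)).
  rewrite (_ : (fun _ => _) = cst 1%R) //.
  by apply/funext => b; rewrite nth_default // size_tuple.
rewrite (_ : (fun _ => _) = (@tnth _ _)^~ (Ordinal lt)); first exact: measurable_tnth.
by apply/funext => b; rewrite (tnth_nth 1%R).
Qed.

Lemma measurable_vweight t v :
  measurable_fun setT (fun b : #|` edges t|.-tuple (measurableTypeR R) => vweight (WTree R t b) v).
Proof. by rewrite /vweight; apply: measurable_prod => j _; exact: measurable_bias. Qed.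

Lemma measurable_sum_vweight t (K : seq (seq nat)) :
  measurable_fun setT (fun b : #|` edges t|.-tuple (measurableTypeR R) =>
    \sum_(v <- K) vweight (WTree R t b) v)%R.
Proof. by apply: measurable_sum => v; exact: measurable_vweight. Qed.

End Marginals.

(** * Comparing the weights of two trees *)

Lemma rtreeP (t : rtree) : is_tree (tree_fset t).
Proof. by case: t => t /= /asboolP. Qed.

Lemma tree_root (t : rtree) : [::] \in tree_fset t.
Proof. by case: t => t /= /asboolP []. Qed.

Lemma tree_take (t : rtree) v j : v \in tree_fset t -> take j v \in tree_fset t.
Proof.
case: t => t /= /asboolP [_ tp _].
elim/last_ind: v => [|v x IH] //= vt.
have [le|lt] := leqP j (size v); last by rewrite take_oversize ?size_rcons.
by rewrite -cats1 takel_cat //; apply/IH/tp/vt.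
Qed.

Lemma take_edges (t : rtree) v j :
  v \in tree_fset t -> (1 <= j < (size v).+1)%N -> take j v \in edges t.
Proof.
move=> vt /andP[j1 jv]; rewrite /edges !inE tree_take // andbT -size_eq0.
by rewrite size_takel // -lt0n.
Qed.

Lemma measurable_gtr d (T : measurableType d) (R : realType) (f : T -> R) (s : R) :
  measurable_fun setT f -> measurable [set x | s < f x].
Proof.
move=> mf; rewrite (_ : [set _ | _] = f @^-1` `]s, +oo[%classic).
  by rewrite -[X in measurable X]setTI; apply: mf => //; exact: measurable_itv.
by apply/seteqP; split=> x /=; rewrite in_itv /= andbT.
Qed.

Lemma ler_sum_sub (R : numDomainType) (I : eqType) (r1 r2 : seq I) (F : I -> R) :
  uniq r1 -> uniq r2 -> {subset r1 <= r2} -> (forall i, 0 <= F i) ->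
  \sum_(i <- r1) F i <= \sum_(i <- r2) F i.
Proof.
move=> u1 u2 s12 F0.
have p : perm_eq (seq.filter (mem r1) r2) r1.
  apply: uniq_perm => //; first exact: filter_uniq.
  by move=> x; rewrite mem_filter /=; case: (boolP (x \in r1)) => // /s12 ->.
by rewrite [leRHS](bigID (mem r1)) /= -[X in _ <= X + _]big_filter (perm_big _ p) lerDl sumr_ge0.
Qed.

Lemma union_bound d (R : realType) (T : measurableType d) (mu : {measure set T -> \bar R})
    (I : eqType) (r : seq I) (V : I -> set T) (c : \bar R) :
  (forall i, measurable (V i)) -> (forall i, i \in r -> mu (V i) <= c)%E ->
  (mu (\big[setU/set0]_(i <- r) V i) <= (size r)%:R%:E * c)%E.
Proof.
move=> mV; elim: r => [|i r IH] Vc; first by rewrite big_nil measure0 mul0e.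
rewrite big_cons; apply: (le_trans (measureU2 _ _ _)) => //.
  by apply: bigsetU_measurable.
have c0 : (0 <= c)%E by apply: (le_trans _ (Vc i (mem_head _ _))); exact: measure_ge0.
rewrite [size _]/= -addn1 natrD EFinD ge0_muleDl ?lee_fin // mul1e.
rewrite addeC; apply: leeD; last by apply: Vc; rewrite mem_head.
by apply: IH => j jr; apply: Vc; rewrite in_cons jr orbT.
Qed.

Section Comparison.
Local Open Scope ereal_scope.
Variables (R : realType) (nu : probability (measurableTypeR R) R).
Hypothesis nu_gt1 : nu `]1%R, +oo[%classic = 1.

Definition tree_tail (t : rtree) (u : R) : \bar R :=
  iid nu _ [set b | (u < tweight (WTree R t b))%R].

(** Biases exceed 1 almost surely but not surely, so monotonicity in the number
    of vertices is only available through this form. *)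
Lemma le_iid_as n (A B : set (n.-tuple (measurableTypeR R))) :
  measurable A -> measurable B ->
  (forall x, (forall i, (1 < tnth x i)%R) -> A x -> B x) -> iid nu n A <= iid nu n B.
Proof.
move=> mA mB AB; pose N := box (fun=> `]1%R, +oo[%classic) : set (n.-tuple (measurableTypeR R)).
have mN : measurable N by apply: measurable_box => i; exact: measurable_itv.
have N1 : iid nu n N = 1 by rewrite iid_box ?big1 // => i; exact: measurable_itv.
have N0 : iid nu n (~` N) = 0 by rewrite probability_setC // N1 subee.
rewrite -(setIT A) -(setUv N) setIUr.
apply: (le_trans (measureU2 _ _ _));
  [exact: measurableI|by apply: measurableI => //; exact: measurableC|].
rewrite [X in _ + X](_ : _ = 0) ?adde0; last first.
  apply/eqP; rewrite eq_le measure_ge0 andbT -N0 le_measure ?inE //;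
    [by apply: measurableI => //; exact: measurableC|exact: measurableC].
rewrite le_measure ?inE //; first exact: measurableI.
move=> x [Ax Nx]; apply: AB => // i; have := Nx i.
by rewrite /= in_itv /= andbT.
Qed.

Lemma measurable_gt_sum_vweight t (K : seq (seq nat)) (s : R) :
  measurable [set b : #|` edges t|.-tuple (measurableTypeR R) |
    (s < \sum_(v <- K) vweight (WTree R t b) v)%R].
Proof.
by apply: measurable_gtr; exact: measurable_sum_vweight.
Qed.
Arguments measurable_gt_sum_vweight : clear implicits.

Lemma measurable_gt_vweight t v (s : R) :
  measurable [set b : #|` edges t|.-tuple (measurableTypeR R) |
    (s < vweight (WTree R t b) v)%R].
Proof.
have := measurable_gt_sum_vweight t [:: v] s.
by under eq_set do rewrite big_seq1.
Qed.

Lemma bias_ge1 t (b : #|` edges t|.-tuple (measurableTypeR R)) e :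
  (forall i, (1 < tnth b i)%R) -> (1 <= bias (WTree R t b) e)%R.
Proof.
move=> b1; rewrite /bias /=; have [le|lt] := leqP #|` edges t| (index e (edges t)).
  by rewrite nth_default // size_tuple.
by have := b1 (Ordinal lt); rewrite (tnth_nth 1%R) => /ltW.
Qed.

Lemma vweight_ge0 t (b : #|` edges t|.-tuple (measurableTypeR R)) v :
  (forall i, (1 < tnth b i)%R) -> (0 <= vweight (WTree R t b) v)%R.
Proof.
by move=> b1; apply: prodr_ge0 => j _; apply: le_trans (bias_ge1 _ b1).
Qed.

(** The edges from the root to v are distinct, hence the law of the weight of v
    depends on its height only. *)
Lemma law_vweight t v s : v \in tree_fset t ->
  iid nu _ [set b | (s < vweight (WTree R t b) v)%R] =
  iid nu (size v) [set x | (s < \prod_(i < size v) tnth x i)%R].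
Proof.
move=> vt; pose E := [tuple take i.+1 v | i < size v].
have mA : measurable [set x : (size v).-tuple (measurableTypeR R) | (s < \prod_(i < size v) tnth x i)%R].
  apply: measurable_gtr; apply: (measurable_prod (s := index_enum _)) => i _.
  exact: measurable_tnth.
rewrite -(@iid_bias _ nu _ t E _ _ _ mA).
- congr (_ _); apply: eq_set => b; congr (_ < _ = true)%R.
  by rewrite /vweight big_add1 big_mkord; apply: eq_bigr => i _; rewrite !tnth_mktuple.
- apply/tuple_uniqP => i j; rewrite !tnth_mktuple => /(congr1 size).
  by rewrite !size_takel // => -[] /val_inj.
- move=> _ /tnthP[i ->]; rewrite tnth_mktuple /edges !inE tree_take // andbT.
  by rewrite -size_eq0 size_takel.
Qed.

Section Embedding.
Variables (t : rtree) (K : seq (seq nat)).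
Hypotheses (uK : uniq K) (Kt : {subset K <= tree_fset t}).
Hypothesis K_take : forall v j, v \in K -> take j v \in K.

(** A part K of t that contains the ancestors of its vertices and is copied into
    S by a height preserving map carries the same weights in t and in S. *)
Lemma law_sum_vweight (S : rtree) (phi : seq nat -> seq nat) s :
  {in K, forall v, phi v \in tree_fset S} -> {in K &, injective phi} ->
  {in K, forall v, size (phi v) = size v} ->
  {in K, forall v j, phi (take j v) = take j (phi v)} ->
  iid nu _ [set b | (s < \sum_(v <- K) vweight (WTree R t b) v)%R] =
  iid nu _ [set b | (s < \sum_(v <- K) vweight (WTree R S b) (phi v))%R].
Proof.
move=> phiS phi_inj phi_size phi_take.
pose E := in_tuple (seq.filter (fun v => v != [::]) K).
pose g (x : seq R) := (\sum_(v <- K) \prod_(1 <= j < (size v).+1) nth 1 x (index (take j v) E))%R.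
have EK v j : v \in K -> (1 <= j < (size v).+1)%N -> take j v \in (E : seq _).
  move=> vK /andP[j1 jv]; rewrite mem_filter K_take // andbT -size_eq0 size_takel //.
  by rewrite -lt0n.
have mA n : measurable [set x : n.-tuple (measurableTypeR R) | (s < g (x : seq _))%R].
  apply: measurable_gtr; apply: measurable_sum => v.
  apply: measurable_prod => j _.
  have [le|lt] := leqP n (index (take j v) E).
    rewrite (_ : (fun _ => _) = cst 1%R) //.
    by apply/funext => b; rewrite nth_default // size_tuple.
  rewrite (_ : (fun _ => _) = (@tnth _ _)^~ (Ordinal lt)); first exact: measurable_tnth.
  by apply/funext => b; rewrite (tnth_nth 1%R).
transitivity (iid nu (size (seq.filter (fun v => v != [::]) K)) [set x | (s < g (x : seq R))%R]).
  rewrite -(@iid_bias _ nu _ t E _ _ _ (mA _)).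
  - congr (_ _); apply: eq_set => b; congr (_ < _ = true)%R.
    rewrite /g !big_seq; apply: eq_bigr => v vK; rewrite /vweight !big_seq.
    apply: eq_bigr => j; rewrite mem_index_iota => /(EK _ _ vK) vE.
    have lt : (index (take j v) E < size (seq.filter (fun v => v != [::]) K))%N by rewrite index_mem.
    rewrite -[RHS](tnth_nth 1%R _ (Ordinal lt)) tnth_mktuple; congr (bias _ _).
    by rewrite (tnth_nth [::]) /= nth_index.
  - exact: filter_uniq.
  - by move=> v; rewrite mem_filter /edges !inE => /andP[-> /Kt].
pose E' := [tuple of map phi E].
rewrite -(@iid_bias _ nu _ S E' _ _ _ (mA _)).
- congr (_ _); apply: eq_set => b; congr (_ < _ = true)%R.
  rewrite /g !big_seq; apply: eq_bigr => v vK; rewrite /vweight !big_seq phi_size //.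
  apply: eq_bigr => j; rewrite mem_index_iota => /(EK _ _ vK) vE.
  have lt : (index (take j v) E < size (seq.filter (fun v => v != [::]) K))%N by rewrite index_mem.
  rewrite -[LHS](tnth_nth 1%R _ (Ordinal lt)) tnth_mktuple; congr (bias _ _).
  by rewrite tnth_map (tnth_nth [::]) /= nth_index // phi_take.
- rewrite map_inj_in_uniq; first exact: filter_uniq.
  by move=> v w; rewrite !mem_filter => /andP[_ vK] /andP[_ wK]; exact: phi_inj.
- move=> _ /mapP[v + ->]; rewrite mem_filter /edges !inE => /andP[v0 vK].
  by rewrite phiS // andbT -size_eq0 phi_size // size_eq0.
Qed.

(** Pigeonhole on the weight: it exceeds u only if one of n quantities exceeds
    u / n, namely the weight of K or that of one of the fewer than n vertices
    outside K.  Each of these vertices is as heavy, in law, as the vertex of K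
    at the same height on the path to v0, so that all n events are at most as
    likely as the one about K. *)
Lemma le_tree_tail_embedding (S : rtree) (phi : seq nat -> seq nat) v0 (n : nat) u :
  {in K, forall v, phi v \in tree_fset S} -> {in K &, injective phi} ->
  {in K, forall v, size (phi v) = size v} ->
  {in K, forall v j, phi (take j v) = take j (phi v)} ->
  v0 \in K -> (forall v, v \in tree_fset t -> (size v <= size v0)%N) ->
  (count (fun v => v \notin K) (tree_fset t) < n)%N -> (0 <= u)%R ->
  tree_tail t u <= n%:R%:E * tree_tail S (u / n%:R).
Proof.
move=> phiS phi_inj phi_size phi_take v0K v0max cn u0.
have n0 : (0 < n)%N by case: (n) cn.
set s := (u / n%:R)%R.
pose r := seq.filter (fun v => v \notin K) (tree_fset t).
pose WK := [set b | (s < \sum_(v <- K) vweight (WTree R t b) v)%R].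
have mWK : measurable WK by exact: measurable_gt_sum_vweight.
pose V v := [set b | (s < vweight (WTree R t b) v)%R].
have mV v : measurable (V v) by exact: measurable_gt_vweight.
have VK v : v \in tree_fset t -> iid nu _ (V v) <= iid nu _ WK.
  move=> vt; have szv : size (take (size v) v0) = size v by rewrite size_takel // v0max.
  have := law_vweight s (Kt (K_take (size v) v0K)); rewrite szv -(law_vweight s vt) => <-.
  apply: le_iid_as; [exact: mV|exact: mWK|move=> b b1 /= /lt_le_trans; apply].
  rewrite -(big_seq1 +%R (take (size v) v0)).
  apply: ler_sum_sub => //; last by move=> w; exact: vweight_ge0.
  by move=> w; rewrite inE => /eqP ->; apply: K_take.
apply: (@le_trans _ _ (n%:R%:E * iid nu _ WK)); last first.
  apply: lee_wpmul2l; first by rewrite lee_fin.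
  rewrite (law_sum_vweight s phiS phi_inj phi_size phi_take).
  apply: le_iid_as => [||b b1 /= /lt_le_trans]; last apply.
  - have := measurable_gt_sum_vweight S (map phi K) s.
    by under eq_set do rewrite big_map.
  - exact: measurable_gt_sum_vweight.
  - rewrite -(big_map phi xpredT (fun v => vweight (WTree R S b) v)).
    apply: ler_sum_sub => [||w|w].
    + by rewrite map_inj_in_uniq.
    + exact: fset_uniq.
    + by move=> /mapP[v vK ->]; exact: phiS.
    + exact: vweight_ge0.
have sub : [set b | (u < tweight (WTree R t b))%R] `<=` WK `|` \big[setU/set0]_(v <- r) V v.
  move=> b /= ub; have [|WKs] := ltP s (\sum_(v <- K) vweight (WTree R t b) v)%R; first by left.
  right; rewrite -bigcup_seq /=.
  apply: contrapT => nV; move: ub; apply/negP; rewrite -leNgt /tweight /=.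
  have -> : u = (s + s *+ n.-1)%R by rewrite -mulrS prednK // -mulr_natr /s divfK ?pnatr_eq0 -?lt0n.
  rewrite (bigID (mem K)) /= -[X in (X + _)%R]big_filter -[X in (_ + X)%R]big_filter; apply: lerD.
    rewrite (perm_big K) //; apply: uniq_perm => //.
      by rewrite filter_uniq // fset_uniq.
    by move=> x; rewrite mem_filter /=; case: (boolP (x \in K)) => // /Kt ->.
  rewrite -/r; apply: (@le_trans _ _ (\sum_(v <- r) s)%R).
    rewrite !big_seq; apply: ler_sum => v vr; rewrite leNgt; apply/negP => Vv.
    by apply: nV; exists v.
  rewrite big_const_seq count_predT iter_addr_0 size_filter.
  by rewrite ler_wpMn2l ?divr_ge0 // -ltnS prednK.
apply: (le_trans (le_measure _ _ _ sub)); rewrite ?inE.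
- exact: measurable_gt_sum_vweight.
- by apply: measurableU => //; apply: bigsetU_measurable => v _.
apply: (le_trans (measureU2 _ _ _)) => //; first by apply: bigsetU_measurable => v _.
apply: (@le_trans _ _ (iid nu _ WK + (size r)%:R%:E * iid nu _ WK)).
  by apply: leeD => //; apply: union_bound => // v; rewrite mem_filter => /andP[_ /VK].
rewrite -[X in X + _]mul1e -ge0_muleDl ?lee_fin // -EFinD nat1r.
by apply: lee_wpmul2r => //; rewrite lee_fin ler_nat size_filter.
Qed.

End Embedding.

(** Below a root edge of bias at least rho, all the weights of t are multiplied
    by at least rho. *)
Lemma le_tree_tail_graft (t t' : rtree) (rho u : R) : (0 < rho)%R ->
  (forall v, v \in tree_fset t -> 1%N :: v \in tree_fset t') ->
  nu `[rho, +oo[%classic * tree_tail t (u / rho) <= tree_tail t' u.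
Proof.
move=> rho0 tt'.
pose E := [tuple of [:: 1%N] :: map (cons 1%N) (in_tuple (edges t))].
pose A := [set x : (#|` edges t|).+1.-tuple (measurableTypeR R) | `[rho, +oo[%classic (thead x) /\
  (u / rho < tweight (WTree R t [tuple of behead x]))%R].
have mT : measurable [set b | (u / rho < tweight (WTree R t b))%R].
  exact: measurable_gt_sum_vweight.
have mI : measurable (`[rho, +oo[%classic : set (measurableTypeR R)) by exact: measurable_itv.
have mA : measurable A.
  rewrite (_ : A = ((@tnth _ _)^~ ord0 @^-1` `[rho, +oo[%classic) `&`
    ((fun x : (#|` edges t|).+1.-tuple (measurableTypeR R) => [tuple of behead x])
      @^-1` [set b | (u / rho < tweight (WTree R t b))%R])) //.
  apply: measurableI; rewrite -[X in measurable X]setTI.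
    exact: (@measurable_tnth _ (measurableTypeR R) _ _ measurableT _ mI).
  exact: (@measurable_behead _ (measurableTypeR R) _ measurableT _ mT).
rewrite -iid_cons //.
rewrite -/A -(@iid_bias _ nu _ t' E A) //; last first.
- move=> v; rewrite /= inE => /predU1P[->|/mapP[w]].
    by rewrite /edges !inE /=; apply/tt'/tree_root.
  by rewrite /edges !inE => /andP[_ wt] -> /=; exact: tt'.
- rewrite /= map_inj_uniq ?fset_uniq ?andbT; last by move=> v w [].
  by apply/negP => /mapP[v]; rewrite /edges !inE => /andP[v0 _] [] /eqP; rewrite eq_sym (negbTE v0).
apply: le_iid_as.
- rewrite (_ : [set b | _] = (fun b => [tuple bias (WTree R t' b) (tnth E i) | i < _]) @^-1` A) //.
  rewrite -[X in measurable X]setTI; apply: (iffRL (measurable_fun_tnthP _)) => // i.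
  rewrite (_ : _ \o _ = fun b => bias (WTree R t' b) (tnth E i)); first exact: measurable_bias.
  by apply/funext => b; rewrite /= tnth_mktuple.
- exact: measurable_gt_sum_vweight.
move=> b b1 [] /=; rewrite in_itv /= andbT /thead tnth_mktuple => b0.
set b' := (X in WTree _ t X) => ub.
have bE e : e \in edges t -> bias (WTree R t b') e = bias (WTree R t' b) (1%N :: e).
  move=> et; have lt : (index e (edges t) < #|` edges t|)%N by rewrite index_mem.
  rewrite [LHS]/bias /b' /= nth_behead.
  transitivity (tnth [tuple bias (WTree R t' b) (tnth E i) | i < (#|` edges t|).+1]
      (lift ord0 (Ordinal lt))); first by rewrite (tnth_nth 1%R).
  rewrite tnth_mktuple.
  by rewrite (tnth_nth [::]) /= (nth_map [::]) ?index_mem // nth_index.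
have vE v : v \in tree_fset t ->
    vweight (WTree R t' b) (1%N :: v) = (bias (WTree R t' b) [:: 1%N] * vweight (WTree R t b') v)%R.
  move=> vt; rewrite /vweight big_nat_recl //=; congr (_ * _)%R.
    by rewrite take0.
  rewrite [LHS]big_nat [RHS]big_nat; apply: eq_bigr => j jv /=.
  by rewrite bE // take_edges.
rewrite /tweight /=.
apply: (@lt_le_trans _ _ (\sum_(v <- [seq 1%N :: v | v <- tree_fset t]) vweight (WTree R t' b) v)%R);
  last first.
  apply: ler_sum_sub => [||w|w].
  - by rewrite map_inj_uniq ?fset_uniq // => v w [].
  - exact: fset_uniq.
  - by move=> /mapP[v vt ->]; exact: tt'.
  - exact: vweight_ge0.
rewrite big_map (eq_big_seq _ vE) -mulr_sumr.
move: ub; rewrite ltr_pdivrMr // => /lt_le_trans; apply.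
rewrite mulrC; apply: ler_wpM2r => //; rewrite /tweight big_seq; apply: sumr_ge0 => v vt.
rewrite /vweight big_nat; apply: prodr_ge0 => j jv.
rewrite bE ?take_edges //; apply: le_trans (bias_ge1 _ b1); exact: ler01.
Qed.

End Comparison.

(** * A tree as the list of the subtrees at its root *)

Definition node_seq (l : seq rtree) : seq (seq nat) :=
  [::] :: flatten [seq [seq q.+1 :: v | v <- tree_fset (nth root_tree l q)] | q <- iota 0 (size l)].

Lemma mem_node_seq_cons l q v :
  (q :: v \in node_seq l) = (0 < q <= size l)%N && (v \in tree_fset (nth root_tree l q.-1)).
Proof.
rewrite in_cons /=; apply/flatten_mapP/andP => [[p]|[]].
  by rewrite mem_iota /= add0n => pl /mapP[w wt [-> ->]].
case: q => // q /= ql vt; exists q; first by rewrite mem_iota.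
by apply/mapP; exists v.
Qed.

Lemma node_seq_uniq l : uniq (node_seq l).
Proof.
rewrite /=; apply/andP; split.
  by apply/negP => /flatten_mapP[q _ /mapP[]].
elim: (iota 0 _) (iota_uniq 0 (size l)) => //= q s IH /andP[qs us].
rewrite cat_uniq IH // andbT map_inj_uniq ?fset_uniq; last by move=> v w [].
apply/hasPn => w /flatten_mapP[p ps /mapP[v _ ->]]; apply/negP => /mapP[v' _ [pq _]].
by rewrite pq (negbTE qs) in ps.
Qed.

Lemma node_treeP l : `[< is_tree (seq_fset tt (node_seq l)) >].
Proof.
apply/asboolP; split; first by rewrite seq_fsetE mem_head.
- move=> u j; rewrite !seq_fsetE; case: u => [//|q u].
  rewrite rcons_cons !mem_node_seq_cons => /andP[-> /=].
  by have [_ tp _] := rtreeP (nth root_tree l q.-1); exact: tp.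
- move=> u; rewrite seq_fsetE; case: u => [_|q u].
    exists (size l) => j; rewrite seq_fsetE mem_node_seq_cons tree_root andbT.
    by [].
  rewrite mem_node_seq_cons => /andP[ql ut].
  have [_ _ /(_ _ ut)[k kP]] := rtreeP (nth root_tree l q.-1); exists k => j.
  by rewrite seq_fsetE rcons_cons mem_node_seq_cons ql /= kP.
Qed.

Definition node l : rtree := RTree (node_treeP l).

Lemma mem_node l v : (v \in tree_fset (node l)) = (v \in node_seq l).
Proof. by rewrite seq_fsetE. Qed.
Arguments node : simpl never.

Lemma mem_node_cons l q v : (q :: v \in tree_fset (node l)) =
  (0 < q <= size l)%N && (v \in tree_fset (nth root_tree l q.-1)).
Proof. by rewrite mem_node mem_node_seq_cons. Qed.

(** Every quantity summed or multiplied over the vertices of a tree satisfies a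
    recursion over the subtrees at its root. *)
Lemma big_node (T : Type) (idx : T) (op : Monoid.com_law idx) l (F : seq nat -> T) :
  \big[op/idx]_(v <- tree_fset (node l)) F v =
  op (F [::]) (\big[op/idx]_(q <- iota 0 (size l))
    \big[op/idx]_(v <- tree_fset (nth root_tree l q)) F (q.+1 :: v)).
Proof.
have pl : perm_eq (tree_fset (node l)) (node_seq l).
  by apply: uniq_perm; [exact: fset_uniq|exact: node_seq_uniq|exact: mem_node].
rewrite (perm_big _ pl) /=.
by rewrite big_cons big_flatten big_map; congr (op _ _); apply: eq_bigr => q _; rewrite big_map.
Qed.

Lemma nchildrenP t u k :
  (forall j, (rcons u j \in tree_fset t) = (1 <= j <= k)%N) -> nchildren t u = k.
Proof.
move=> uk; rewrite /nchildren.
rewrite (_ : [fset v in _ | _]%fset = [fset rcons u j | j in iota 1 k]%fset).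
  rewrite card_imfset /= ?undup_id ?iota_uniq ?size_iota //.
  exact: rcons_injr.
apply/fsetP => v; rewrite !inE /=; apply/andP/imfsetP => /=.
  case=> vt /andP[v0]; rewrite /parent; case/lastP: v vt v0 => // v j vt _.
  rewrite size_rcons /= -cats1 take_size_cat // cats1 => /eqP vu.
  by exists j; rewrite ?vu // mem_iota add1n ltnS -uk -vu.
move=> [j]; rewrite mem_iota add1n ltnS => jk ->; rewrite uk; split => //.
by rewrite -size_eq0 size_rcons /= /parent size_rcons /= -cats1 take_size_cat.
Qed.

Lemma tree_nchildren t u : u \in tree_fset t ->
  forall j, (rcons u j \in tree_fset t) = (1 <= j <= nchildren t u)%N.
Proof.
move=> ut; have [k kP] : exists k, forall j, (rcons u j \in tree_fset t) = (1 <= j <= k)%N.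
  by have [_ _] := rtreeP t; exact.
by rewrite (nchildrenP kP).
Qed.

Lemma nchildren_node_root l : nchildren (node l) [::] = size l.
Proof. by apply: nchildrenP => j; rewrite mem_node_cons tree_root andbT. Qed.

Lemma nchildren_node_cons l q v : (q < size l)%N -> v \in tree_fset (nth root_tree l q) ->
  nchildren (node l) (q.+1 :: v) = nchildren (nth root_tree l q) v.
Proof.
move=> ql vt; apply: nchildrenP => j.
by rewrite rcons_cons mem_node_cons ql /= tree_nchildren.
Qed.

Lemma rtree_eqP (t t' : rtree) : tree_fset t =i tree_fset t' -> t = t'.
Proof. by move=> tt'; apply/val_inj/fsetP. Qed.

Lemma node_nil : node [::] = root_tree.
Proof.
apply: rtree_eqP => -[|q v]; first by rewrite !tree_root.
by rewrite mem_node_cons leqn0 inE; case: q.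
Qed.

Lemma node_inj : injective node.
Proof.
move=> l l' ll'; have sz : size l = size l' by rewrite -!nchildren_node_root ll'.
apply: (@eq_from_nth _ root_tree) => // q ql; apply: rtree_eqP => v.
transitivity (q.+1 :: v \in tree_fset (node l)); first by rewrite mem_node_cons ql.
by rewrite ll' mem_node_cons -sz ql.
Qed.

(** The default value is taken only when q is not a child of the root. *)
Definition subtree (t : rtree) (q : nat) : rtree :=
  insubd root_tree [fset behead v | v in tree_fset t & (v != [::]) && (head 0%N v == q)]%fset.

Lemma mem_subtree t q v : [:: q] \in tree_fset t ->
  (v \in tree_fset (subtree t q)) = (q :: v \in tree_fset t).
Proof.
move=> qt; set A := [fset behead v | v in tree_fset t & (v != [::]) && (head 0%N v == q)]%fset.
have AE w : (w \in A) = (q :: w \in tree_fset t).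
  apply/imfsetP/idP => [[[|p x]] /=|qw]; rewrite ?inE ?andbF //=.
    by move=> /andP[xt /eqP <-] ->.
  by exists (q :: w) => //; rewrite !inE /= eqxx andbT.
have AP : `[< is_tree A >].
  apply/asboolP; split; first by rewrite AE.
  - move=> u j; rewrite !AE -rcons_cons.
    by have [_ tp _] := rtreeP t; exact: tp.
  - move=> u; rewrite AE => ut; exists (nchildren t (q :: u)) => j.
    by rewrite AE -rcons_cons tree_nchildren.
by rewrite -AE /subtree -[tree_fset _]/(val _) val_insubd AP.
Qed.

Lemma node_surj t : exists l, node l == t.
Proof.
exists [seq subtree t q | q <- iota 1 (nchildren t [::])]; apply/eqP/rtree_eqP.
case=> [|q v]; first by rewrite !tree_root.
rewrite mem_node_cons size_map size_iota.
have qE := tree_nchildren (tree_root t) q.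
have [/andP[q0 qk]|qn] := boolP (0 < q <= _)%N; last first.
  apply/esym/negP => /(tree_take 1); rewrite /= take0 -[[:: q]]/(rcons [::] q) qE.
  by rewrite (negbTE qn).
rewrite (nth_map 0%N) ?size_iota ?nth_iota ?add1n ?prednK // mem_subtree //.
by rewrite -[[:: q]]/(rcons [::] q) qE q0.
Qed.

Definition kids t : seq rtree := xchoose (node_surj t).

Lemma kidsK : cancel kids node.
Proof. by move=> t; apply/eqP/(xchooseP (node_surj t)). Qed.

Lemma nodeK : cancel node kids.
Proof. by move=> l; apply: node_inj; rewrite kidsK. Qed.

Lemma card_node l : #|` tree_fset (node l)| = (\sum_(x <- l) #|` tree_fset x|).+1.
Proof.
rewrite -sum1_size big_node -add1n; congr addn.
rewrite [RHS](big_nth root_tree) /index_iota subn0; apply: eq_bigr => q _.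
by rewrite sum1_size.
Qed.

Lemma rtree_ind (P : rtree -> Prop) :
  (forall l, (forall x, x \in l -> P x) -> P (node l)) -> forall t, P t.
Proof.
move=> nP t; have [n] := ubnP #|` tree_fset t|; elim: n t => // n IH t.
rewrite -(kidsK t) ltnS => tn; apply: nP => x xl; apply: IH.
by apply: leq_trans tn; rewrite card_node ltnS (big_rem x) //= leq_addr.
Qed.

(** * Depth, base vertex, spine and outgrowths *)

Lemma leq_depth t v : v \in tree_fset t -> (size v <= depth t)%N.
Proof. by move=> vt; exact: (@leq_bigmax _ (fun v : tree_fset t => size (val v)) [` vt]%fset). Qed.

Lemma depth_witness t : exists2 v, v \in tree_fset t & size v = depth t.
Proof.
have t0 : (0 < #|{: tree_fset t}|)%N by apply/card_gt0P; exists [` tree_root t]%fset.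
rewrite /depth; have [v ->] := bigop.eq_bigmax (fun v : tree_fset t => size (val v)) t0.
by exists (val v) => //; exact: valP.
Qed.

Lemma depth_eq t n : (forall v, v \in tree_fset t -> (size v <= n)%N) ->
  (exists2 v, v \in tree_fset t & size v = n) -> depth t = n.
Proof.
move=> tn [v vt vn]; apply/eqP; rewrite eqn_leq -{2}vn leq_depth // andbT.
by have [w wt <-] := depth_witness t; exact: tn.
Qed.

Lemma depth_root_tree : depth root_tree = 0%N.
Proof. by have [[|q v]] := depth_witness root_tree; [move=> _ <-|rewrite inE]. Qed.

Lemma kids_neq0 t : (0 < depth t)%N -> kids t != [::].
Proof.
by apply: contraTneq => l0; rewrite -(kidsK t) l0 node_nil depth_root_tree.
Qed.

(** The base vertex is the leftmost deepest one, so the spine enters the first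
    of the deepest subtrees: strict inequality on its left, weak on its right. *)
Definition deepest_split (l1 : seq rtree) (x : rtree) (l2 : seq rtree) : bool :=
  all (fun y => depth y < depth x)%N l1 && all (fun y => depth y <= depth x)%N l2.

Definition argdeep (l : seq rtree) : nat :=
  find (fun x => all (fun y => depth y <= depth x)%N l) l.

Lemma has_deepest l : l != [::] -> has (fun x => all (fun y => depth y <= depth x)%N l) l.
Proof.
case: l => // x0 l _; elim: l x0 => [|y l IH] x0; first by rewrite /= leqnn.
have [yx|/ltnW xy] := leqP (depth y) (depth x0).
  have /hasP[z zl za] := IH x0; apply/hasP; exists z.
    by move: zl; rewrite !inE => /orP[->|->] //; rewrite !orbT.
  by move: za => /= /andP[x0z ->]; rewrite x0z (leq_trans yx x0z).
have /hasP[z zl za] := IH y; apply/hasP; exists z; first by rewrite inE zl orbT.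
by move: za => /= /andP[yz ->]; rewrite yz (leq_trans xy yz).
Qed.

Lemma argdeep_lt l : l != [::] -> (argdeep l < size l)%N.
Proof. by move/has_deepest; rewrite has_find. Qed.

Lemma argdeepP l : l != [::] ->
  deepest_split (take (argdeep l) l) (nth root_tree l (argdeep l)) (drop (argdeep l).+1 l).
Proof.
move=> l0; have /(nth_find root_tree) /allP mx := has_deepest l0.
rewrite -/(argdeep l) in mx; apply/andP; split; apply/allP => y yl; last first.
  exact/mx/mem_drop/yl.
have /(nthP root_tree)[q ql qy] := yl.
have qm : (q < argdeep l)%N by rewrite size_takel // in ql; rewrite ltnW // argdeep_lt.
have := before_find root_tree qm; rewrite -(nth_take root_tree qm) qy.
move=> /negbT /allPn[z zl]; rewrite -ltnNge => /leq_trans; apply; exact: mx.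
Qed.

Lemma argdeep_split l : l != [::] ->
  take (argdeep l) l ++ nth root_tree l (argdeep l) :: drop (argdeep l).+1 l = l.
Proof. by move=> l0; rewrite -drop_nth ?argdeep_lt // cat_take_drop. Qed.

(** The split is recovered from the depths of the subtrees alone. *)
Lemma deepest_split_uniq l1 x l2 : deepest_split l1 x l2 ->
  argdeep (l1 ++ x :: l2) = size l1.
Proof.
move=> /andP[/allP s1 /allP s2]; rewrite /argdeep find_cat.
have mx : all (fun y => depth y <= depth x)%N (l1 ++ x :: l2).
  by apply/allP => y; rewrite mem_cat inE => /or3P[/s1/ltnW|/eqP->|/s2].
rewrite ifN /= ?mx ?addn0 //.
apply/hasPn => y yl1; apply/allPn; exists x; first by rewrite mem_cat mem_head orbT.
by rewrite -ltnNge s1.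
Qed.

Lemma depth_node_split l1 x l2 : deepest_split l1 x l2 ->
  depth (node (l1 ++ x :: l2)) = (depth x).+1.
Proof.
move=> /andP[/allP s1 /allP s2]; apply: depth_eq => [[|q v]//|].
  rewrite mem_node_cons => /andP[/andP[q0 ql] /leq_depth vx] /=; rewrite ltnS.
  apply: (leq_trans vx); have : nth root_tree (l1 ++ x :: l2) q.-1 \in l1 ++ x :: l2.
    by rewrite mem_nth // prednK.
  by rewrite mem_cat inE => /or3P[/s1/ltnW|/eqP->|/s2].
have [v vx vd] := depth_witness x; exists ((size l1).+1 :: v); last by rewrite /= vd.
by rewrite mem_node_cons /= nth_cat ltnn subnn vx andbT size_cat /= addnS ltnS leq_addr.
Qed.

(** Specification of [vbase], more convenient than its definition by [pick]. *)
Definition is_vbase t v := [/\ v \in tree_fset t, size v = depth t &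
  forall w, w \in tree_fset t -> size w = depth t -> ((v : seqlexi nat) <= (w : seqlexi nat))%O].

Lemma vbaseE t v : is_vbase t v -> vbase t = v.
Proof.
move=> [vt vd vmin]; rewrite /vbase; case: pickP => [w /andP[/eqP wd /forallP wmin]|no] /=.
  have vw := vmin (val w) (valP w) wd.
  have wv := implyP (wmin [` vt]%fset); rewrite /= vd eqxx in wv.
  by apply/eqP; rewrite (@eq_le _ (seqlexi nat)) vw (wv isT).
have := no [` vt]%fset; rewrite /= vd eqxx /= => /negP[]; apply/forallP => w.
by apply/implyP => /eqP wd; apply: vmin => //; exact: valP.
Qed.

(** Among the deepest vertices, lexicographic comparison first looks at the
    subtree at the root, which makes the base vertex recursive. *)
Lemma is_vbase_node l1 x l2 v : deepest_split l1 x l2 -> is_vbase x v ->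
  is_vbase (node (l1 ++ x :: l2)) ((size l1).+1 :: v).
Proof.
move=> ds [vx vd vmin]; rewrite /is_vbase (depth_node_split ds); split.
- by rewrite mem_node_cons /= nth_cat ltnn subnn vx andbT size_cat /= addnS ltnS leq_addr.
- by rewrite /= vd.
case=> // q w; rewrite mem_node_cons => /andP[/andP[q0 ql] wt] /= [wd].
rewrite lexi_cons; move: ds => /andP[/allP s1 _].
have lq : (size l1 < q)%N.
  rewrite ltnNge; apply/negP => ql1.
  have ql1' : (q.-1 < size l1)%N by rewrite prednK.
  move: wt; rewrite nth_cat ql1' => /leq_depth; rewrite wd leqNgt s1 //.
  exact: mem_nth.
rewrite leEnat lq /=; apply/implyP => ql1; apply: vmin => //.
have /eqP qE : q == (size l1).+1 by rewrite eqn_leq lq ql1.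
by move: wt; rewrite qE /= nth_cat ltnn subnn.
Qed.

Lemma vbaseP t : is_vbase t (vbase t).
Proof.
suff [v vP] : exists v, is_vbase t v by rewrite (vbaseE vP).
elim/rtree_ind: t => l IH; have [->|l0] := eqVneq l [::].
  exists [::]; split=> [||w _ _]; [exact: tree_root| |exact: Order.SeqLexiOrder.lexi0s].
  apply/esym/depth_eq => [[|q v]//|]; last by exists [::]; rewrite ?tree_root.
  by rewrite mem_node_cons leqn0; case: q.
have xl : nth root_tree l (argdeep l) \in l by rewrite mem_nth // argdeep_lt.
have [v vP] := IH _ xl; exists ((argdeep l).+1 :: v).
have := is_vbase_node (argdeepP l0) vP.
by rewrite argdeep_split // size_takel // ltnW // argdeep_lt.
Qed.

Lemma size_vbase t : size (vbase t) = depth t.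
Proof. by have [] := vbaseP t. Qed.

Lemma vbase_mem t : vbase t \in tree_fset t.
Proof. by have [] := vbaseP t. Qed.

Lemma spine_node l1 x l2 i : deepest_split l1 x l2 ->
  spine (node (l1 ++ x :: l2)) i.+1 = (size l1).+1 :: spine x i.
Proof.
by move=> ds; rewrite /spine (vbaseE (is_vbase_node ds (vbaseP x))).
Qed.

Lemma size_spine t i : (i <= depth t)%N -> size (spine t i) = i.
Proof. by move=> it; rewrite size_takel // size_vbase. Qed.

Lemma spine_mem t i : spine t i \in tree_fset t.
Proof. exact/tree_take/vbase_mem. Qed.

(** Vertices below the i-th spine vertex but not below the next one.  If the
    spine ends at height i, then [spine t i.+1] is [spine t i] again, whence the
    first alternative. *)
Definition hangs t i v := prefix (spine t i) v && ((depth t <= i)%N || ~~ prefix (spine t i.+1) v).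

Lemma prefix_parent (s v : seq nat) : v != [::] -> prefix s v -> s = v \/ prefix s (parent v).
Proof.
case/lastP: v => // v x _ /prefixP[s' e].
case/lastP: s' e => [|s' y]; first by rewrite cats0 => ->; left.
rewrite -rcons_cat => /rcons_inj[-> _]; right.
by rewrite /parent size_rcons /= -cats1 take_size_cat // prefix_prefix.
Qed.

Lemma prefix_of_parent (s v : seq nat) : prefix s (parent v) -> prefix s v.
Proof. by move/prefix_trans; apply; rewrite prefix_take. Qed.

(** The set of hanging vertices is closed under adjacency: an edge that leaves it
    is the spine edge above the i-th spine vertex or the one below it, and both
    have been deleted. *)
Lemma outgrowth_hangs t i v : v \in outgrowth t i -> v \in tree_fset t /\ hangs t i v.
Proof.
rewrite /outgrowth; case: leqP => [it|]; last by rewrite inE.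
move=> /imfsetP[/= w]; rewrite inE => /existsP[r /andP[/eqP rE rw]] ->; split; first exact: valP.
have hr : hangs t i (val r).
  rewrite (_ : val r = spine t i) // /hangs prefix_refl /=; case: leqP => //= lt.
  by apply/negP => /size_prefix; rewrite !size_spine // ltnn.
have se q : (0 < q)%N -> (q <= depth t)%N -> spine_edge t (spine t q).
  move=> q0; rewrite -ltnS => qd; apply/existsP; exists (Ordinal qd); rewrite /=.
  by rewrite q0 eqxx.
case/connectP: rw => p; elim: p r {rE} hr => [r hr _ -> //|z p IH r hr /= /andP[rz pz] wp].
apply: IH pz wp; move: rz hr; rewrite /outgrowth_adj /hangs.
move=> /orP[/and3P[ze /eqP zr zs]|/and3P[re /eqP zr rs]] /andP[ir ndr].
  have z0 : val z != [::] by move: ze; rewrite /edges !inE => /andP[].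
  rewrite (prefix_of_parent (v := val z)) ?zr //=; case: leqP ndr => //= lt ndr.
  apply/negP => /(prefix_parent z0)[zi|]; last by rewrite zr (negbTE ndr).
  by move: zs; rewrite -zi se.
have r0 : val r != [::] by move: re; rewrite /edges !inE => /andP[].
apply/andP; split; last first.
  by case: leqP ndr => //= lt; apply: contra; rewrite -zr; exact: prefix_of_parent.
have [ri|] := prefix_parent r0 ir; last by rewrite zr.
move: rs; rewrite -ri; case: (i) (it) ri => [|j] jt.
  by rewrite /spine take0 => e; rewrite -e in r0.
by rewrite se.
Qed.

Lemma card_outgrowth_le t i : (#|` outgrowth t i| <= count (hangs t i) (tree_fset t))%N.
Proof.
rewrite -size_filter; apply: uniq_leq_size; first exact: fset_uniq.
by move=> v /outgrowth_hangs[vt hv]; rewrite mem_filter hv.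
Qed.

Lemma card_outgrowth_end t i : (depth t <= i)%N -> (#|` outgrowth t i| <= 1)%N.
Proof.
move=> it; apply: (@leq_trans (size [:: spine t i])) => //.
apply: uniq_leq_size; first exact: fset_uniq.
move=> v /outgrowth_hangs[/leq_depth vt /andP[/prefixP[s vs] _]]; rewrite inE.
move: vt; rewrite vs /spine take_oversize ?size_vbase // size_cat size_vbase.
by rewrite -[X in (_ <= X)%N]addn0 leq_add2l leqn0 size_eq0 => /eqP ->; rewrite cats0.
Qed.

(** * Pruning an outgrowth *)

(** The g additional leaves give the new root a number of children that has
    positive probability even when single children are impossible. *)
Definition plant (g : nat) (t : rtree) : rtree := node (t :: nseq g root_tree).

Lemma plant_inj g : injective (plant g).
Proof. by move=> x y /node_inj []. Qed.

(** Replaces the i-th outgrowth by g leaves.  The spine child is moved to the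
    first place, and it stays the leftmost deepest one there. *)
Fixpoint prune (g i : nat) (t : rtree) : rtree :=
  let l := kids t in
  let x := nth root_tree l (argdeep l) in
  if i is j.+1 then node (take (argdeep l) l ++ prune g j x :: drop (argdeep l).+1 l)
  else plant g x.

(** The recursion follows that of [prune]. *)
Fixpoint outgrowth_size (i : nat) (t : rtree) : nat :=
  let l := kids t in
  let x := nth root_tree l (argdeep l) in
  if i is j.+1 then outgrowth_size j x
  else (\sum_(y <- take (argdeep l) l ++ drop (argdeep l).+1 l) #|` tree_fset y|).+1.

Section Split.
Variables (l1 : seq rtree) (x : rtree) (l2 : seq rtree).
Hypothesis ds : deepest_split l1 x l2.
Let l := l1 ++ x :: l2.

Let take_l : take (argdeep l) l = l1.
Proof. by rewrite /l deepest_split_uniq // take_size_cat. Qed.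

Let drop_l : drop (argdeep l).+1 l = l2.
Proof. by rewrite /l deepest_split_uniq // -cat_rcons drop_size_cat ?size_rcons. Qed.

Let nth_l : nth root_tree l (argdeep l) = x.
Proof. by rewrite /l deepest_split_uniq // nth_cat ltnn subnn. Qed.

Lemma prune0_split g : prune g 0 (node l) = plant g x.
Proof. by rewrite /= nodeK nth_l. Qed.

Lemma pruneS_split g i : prune g i.+1 (node l) = node (l1 ++ prune g i x :: l2).
Proof. by rewrite /= nodeK take_l drop_l nth_l. Qed.

Lemma outgrowth_size0_split : outgrowth_size 0 (node l) = (\sum_(y <- l1 ++ l2) #|` tree_fset y|).+1.
Proof. by rewrite /= nodeK take_l drop_l. Qed.

Lemma outgrowth_sizeS_split i : outgrowth_size i.+1 (node l) = outgrowth_size i x.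
Proof. by rewrite /= nodeK nth_l. Qed.

Lemma mem_split_deepest v : ((size l1).+1 :: v \in tree_fset (node l)) = (v \in tree_fset x).
Proof.
by rewrite mem_node_cons /= /l nth_cat ltnn subnn size_cat /= addnS ltnS leq_addr.
Qed.

End Split.

Arguments prune : simpl never.
Arguments outgrowth_size : simpl never.

(** Induction down the spine, for heights strictly below the depth. *)
Lemma spine_ind (P : nat -> rtree -> Prop) :
  (forall l1 x l2, deepest_split l1 x l2 -> P 0%N (node (l1 ++ x :: l2))) ->
  (forall l1 x l2 i, deepest_split l1 x l2 -> (i < depth x)%N -> P i x ->
     P i.+1 (node (l1 ++ x :: l2))) ->
  forall i t, (i < depth t)%N -> P i t.
Proof.
move=> P0 PS; elim=> [|i IH] t it; have l0 := kids_neq0 (leq_ltn_trans (leq0n _) it).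
  by rewrite -(kidsK t) -(argdeep_split l0); apply/P0/argdeepP.
have ds := argdeepP l0; move: it.
rewrite -(kidsK t) -(argdeep_split l0) (depth_node_split ds) ltnS => it.
by apply: PS => //; exact: IH.
Qed.

Lemma depth_prune g i t : (i < depth t)%N -> depth (prune g i t) = depth t.
Proof.
move=> it; elim/spine_ind: i t / it => [l1 x l2 ds|l1 x l2 i ds ix IH].
  rewrite prune0_split // (depth_node_split ds) (@depth_node_split [::]) //.
  rewrite /deepest_split /=; apply/allP => y /nseqP[-> _].
  by rewrite depth_root_tree.
rewrite pruneS_split // (depth_node_split ds) depth_node_split ?IH //.
by rewrite /deepest_split IH.
Qed.

Lemma hangs_split0 l1 x l2 : deepest_split l1 x l2 ->
  forall v, hangs (node (l1 ++ x :: l2)) 0 v = ~~ prefix [:: (size l1).+1] v.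
Proof.
by move=> ds v; rewrite /hangs spine_node // (depth_node_split ds) /spine !take0 prefix0s.
Qed.

Lemma hangs_splitS l1 x l2 i v : deepest_split l1 x l2 ->
  hangs (node (l1 ++ x :: l2)) i.+1 v =
  if v is q :: w then (q == (size l1).+1) && hangs x i w else false.
Proof.
move=> ds; rewrite /hangs !spine_node // (depth_node_split ds) ltnS.
by case: v => // q w; rewrite !prefix_cons eq_sym; case: eqP.
Qed.

Lemma count_hangs_le i t : (i < depth t)%N ->
  (count (hangs t i) (tree_fset t) <= outgrowth_size i t)%N.
Proof.
move=> it; elim/spine_ind: i t / it => [l1 x l2 ds|l1 x l2 i ds ix IH].
  rewrite outgrowth_size0_split // -(leq_add2r #|` tree_fset x|).
  apply: (@leq_trans #|` tree_fset (node (l1 ++ x :: l2))|); last first.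
    by rewrite card_node !big_cat big_cons /= addSn ltnS addnAC addnA.
  rewrite -[X in (_ <= X)%N](count_predC (hangs (node (l1 ++ x :: l2)) 0)) leq_add2l.
  rewrite -size_filter -[X in (X <= _)%N](size_map (cons (size l1).+1)).
  apply: uniq_leq_size; first by rewrite map_inj_uniq ?fset_uniq // => v w [].
  move=> _ /mapP[v vx ->]; rewrite mem_filter mem_split_deepest // vx andbT /=.
  by rewrite hangs_split0 // negbK prefix_cons eqxx prefix0s.
rewrite outgrowth_sizeS_split //; apply: leq_trans IH; rewrite -!size_filter.
rewrite -[X in (_ <= X)%N](size_map (cons (size l1).+1)).
apply: uniq_leq_size; first by rewrite filter_uniq // fset_uniq.
move=> v; rewrite mem_filter hangs_splitS //; case: v => // q w /andP[/andP[/eqP -> hw]].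
by rewrite mem_split_deepest // => wx; apply/mapP; exists w => //; rewrite mem_filter hw.
Qed.

(** What is left of t when its i-th outgrowth is reduced to the spine vertex. *)
Definition kept t i : seq (seq nat) :=
  [seq v <- tree_fset t | ~~ hangs t i v || (v == spine t i)].

(** Copies [kept t i] into the pruned tree: the spine child becomes the first
    child of the i-th spine vertex. *)
Definition relabel t i (v : seq nat) : seq nat :=
  if prefix (spine t i.+1) v then spine t i ++ 1%N :: drop i.+1 v else v.

Lemma kept_uniq t i : uniq (kept t i).
Proof. by rewrite filter_uniq // fset_uniq. Qed.

Section Kept.
Variables (t : rtree) (i : nat).
Hypothesis it : (i < depth t)%N.

Let si : size (spine t i) = i. Proof. by rewrite size_spine // ltnW. Qed.
Let sSi : size (spine t i.+1) = i.+1. Proof. by rewrite size_spine. Qed.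
Let take_spine : take i (spine t i.+1) = spine t i.
Proof. by rewrite /spine take_takel. Qed.

Lemma hangsE v : hangs t i v = prefix (spine t i) v && ~~ prefix (spine t i.+1) v.
Proof. by rewrite /hangs leqNgt it. Qed.

Lemma hangs_spine : hangs t i (spine t i).
Proof.
rewrite hangsE prefix_refl; apply/negP => /size_prefix.
by rewrite si sSi ltnn.
Qed.

Lemma kept_sub : {subset kept t i <= tree_fset t}.
Proof. by move=> v; rewrite mem_filter => /andP[]. Qed.

Lemma kept_take v j : v \in kept t i -> take j v \in kept t i.
Proof.
rewrite !mem_filter => /andP[vk vt]; rewrite tree_take // andbT.
have [jv|/ltnW vj] := leqP j (size v); last by rewrite take_oversize.
have [ij|ji] := leqP i j; last first.
  apply/orP; left; rewrite hangsE; apply/nandP; left; apply/negP => /size_prefix.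
  by rewrite si size_takel // leqNgt ji.
have [-> //|jneq] := eqVneq j (size v); first by rewrite take_size.
have {jneq}jv : (j < size v)%N by rewrite ltn_neqAle jneq.
have [ps|nps] := boolP (prefix (spine t i.+1) v); last first.
  case/orP: vk => [|/eqP vs]; last by move: jv; rewrite vs si ltnNge ij.
  rewrite !hangsE nps andbT => npi; apply/orP; left; apply/nandP; left.
  by apply: contra npi => /prefix_trans; apply; rewrite prefix_take.
move: ij; rewrite leq_eqVlt => /predU1P[<-|ij].
  apply/orP; right; rewrite -take_spine; move: ps; rewrite prefixE sSi => /eqP <-.
  by rewrite take_takel.
apply/orP; left; rewrite hangsE negb_and negbK; apply/orP; right.
by move: ps; rewrite !prefixE sSi take_takel.
Qed.

Lemma vbase_kept : vbase t \in kept t i.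
Proof.
rewrite mem_filter vbase_mem andbT hangsE negb_and negbK.
by rewrite [prefix (spine t i.+1) _]prefix_take orbT.
Qed.

Lemma count_notin_kept : (count (fun v => v \notin kept t i) (tree_fset t) < outgrowth_size i t)%N.
Proof.
apply: leq_trans (count_hangs_le it); rewrite -!size_filter.
have sp : spine t i \notin [seq v <- tree_fset t | v \notin kept t i].
  by rewrite !mem_filter eqxx orbT spine_mem.
rewrite -[X in (X <= _)%N]/(size (spine t i :: [seq v <- tree_fset t | v \notin kept t i])).
apply: uniq_leq_size; first by rewrite /= sp filter_uniq // fset_uniq.
move=> v; rewrite inE => /predU1P[->|]; first by rewrite mem_filter hangs_spine spine_mem.
by rewrite !mem_filter => /andP[+ vt]; rewrite vt !andbT negb_or negbK => /andP[-> _].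
Qed.

Lemma size_relabel v : size (relabel t i v) = size v.
Proof.
rewrite /relabel; case: ifP => // /prefixP[w ->].
by rewrite drop_size_cat // !size_cat si sSi addSnnS.
Qed.

Lemma relabel_take : {in kept t i, forall v j, relabel t i (take j v) = take j (relabel t i v)}.
Proof.
move=> v _ j; rewrite /relabel; case: (boolP (prefix (spine t i.+1) v)) => [|nps].
  move=> /prefixP[w ->]; have [ji|ij] := leqP j i; last first.
    have -> : take j (spine t i.+1 ++ w) = spine t i.+1 ++ take (j - i.+1) w.
      by rewrite take_cat sSi ltnNge ij.
    rewrite prefix_prefix !drop_size_cat // [RHS]take_cat si ltnNge (ltnW ij) /=.
    by rewrite -(subnSK ij).
  rewrite ifN; last first.
    apply/negP => /size_prefix; rewrite sSi size_take; case: ifP => [|/negbT]; lia.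
  rewrite [LHS]takel_cat ?[RHS]takel_cat ?si ?sSi ?ltnS ?leqW // -take_spine take_takel //.
rewrite ifN //; apply: contra nps => /prefix_trans; apply; exact: prefix_take.
Qed.

Lemma relabel_inj : {in kept t i &, injective (relabel t i)}.
Proof.
have mix v w : w \in kept t i -> prefix (spine t i.+1) v -> ~~ prefix (spine t i.+1) w ->
    spine t i ++ 1%N :: drop i.+1 v = w -> False.
  move=> wk pv pw wE; move: wk; rewrite mem_filter hangsE pw -wE prefix_prefix /=.
  move=> /andP[/eqP/(congr1 size)]; rewrite size_cat /= si; lia.
move=> v w vk wk; rewrite /relabel.
case: (boolP (prefix _ v)) => pv; case: (boolP (prefix _ w)) => pw // e.
- move: e => /eqP; rewrite eqseq_cat // eqxx /= eqseq_cons eqxx /= => /eqP.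
  case/prefixP: pv => v' ->; case/prefixP: pw => w' ->.
  by rewrite !drop_size_cat // => ->.
- by case: (mix v w).
- by case: (mix w v).
Qed.

End Kept.

Lemma relabel_prune g i t : (i < depth t)%N ->
  {in kept t i, forall v, relabel t i v \in tree_fset (prune g i t)}.
Proof.
move=> it; elim/spine_ind: i t / it => [l1 x l2 ds|l1 x l2 i ds ix IH] v.
  rewrite mem_filter hangs_split0 // negbK prune0_split // /relabel.
  rewrite spine_node // /spine !take0 => /andP[+ vt]; case: v vt => [|q v].
    by rewrite prefixs0 => _ _; exact: (tree_root (node _)).
  rewrite prefix_cons prefix0s andbT orbF => + qE; rewrite qE.
  by rewrite -(eqP qE) mem_split_deepest // mem_node_cons /= drop0.
rewrite mem_filter hangs_splitS // pruneS_split // /relabel !spine_node //.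
case: v => [|q v]; first by rewrite prefixs0 => _; exact: (tree_root (node _)).
rewrite prefix_cons eq_sym; case: (eqVneq q (size l1).+1) => [->|qm] /=.
  rewrite mem_split_deepest // eqseq_cons eqxx /= => vk.
  have := IH v; rewrite mem_filter => /(_ vk); rewrite /relabel.
  have dsp : deepest_split l1 (prune g i x) l2 by rewrite /deepest_split depth_prune.
  by case: ifP => _ vp; rewrite mem_split_deepest.
move=> vt; rewrite mem_node_cons.
move: vt; rewrite mem_node_cons !size_cat /= => /andP[/[dup] /andP[q0 _] -> /=].
rewrite !nth_cat; case: ifP => // /negbT; rewrite -leqNgt => mq.
case e: (q.-1 - size l1)%N => [|p] //=.
by case/eqP: qm; lia.
Qed.

(** * Sums over countable types *)

Section EsumExtra.
Local Open Scope ereal_scope.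
Variable R : realType.

Lemma esumZl (T : choiceType) (P : set T) (a : T -> \bar R) (c : R) : (0 <= c)%R ->
  (forall i, P i -> 0 <= a i) ->
  \esum_(i in P) (c%:E * a i) = c%:E * \esum_(i in P) a i.
Proof.
have le_Z (b : T -> \bar R) (d : R) : (0 <= d)%R -> (forall i, P i -> 0 <= b i) ->
    \esum_(i in P) (d%:E * b i) <= d%:E * \esum_(i in P) b i.
  move=> d0 b0; apply: ge_ereal_sup => _ [X [finX XP]] <-.
  rewrite fsbig_finite //= big_seq -ge0_sume_distrr; last first.
    by move=> i; rewrite in_fset_set // inE => /XP /b0.
  apply: lee_wpmul2l; rewrite ?lee_fin // -big_seq -fsbig_finite //.
  by apply: esum_ge; exists X.
move=> c0 a0; apply/eqP; rewrite eq_le le_Z //=.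
have [->|cn0] := eqVneq c 0%R.
  by rewrite mul0e esum_ge0 // => i Pi; rewrite mul0e.
have {c0 cn0}c0 : (0 < c)%R by rewrite lt_def cn0.
have := le_Z (fun i => c%:E * a i) c^-1%R.
rewrite invr_ge0 (ltW c0) => /(_ isT) leV.
have {leV} := leV (fun i Pi => mule_ge0 (ltW c0 : 0 <= c%:E) (a0 i Pi)).
under eq_esum do rewrite muleA -EFinM mulVf ?gt_eqF // mul1e.
move=> /(lee_wpmul2l (ltW c0 : 0 <= c%:E)).
by rewrite muleA -EFinM divff ?gt_eqF // mul1e.
Qed.

Lemma esumZr_le (T : choiceType) (P : set T) (a : T -> \bar R) (C : \bar R) :
  (forall i, P i -> 0 <= a i) -> 0 <= C ->
  \esum_(i in P) (a i * C) <= (\esum_(i in P) a i) * C.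
Proof.
move=> a0 C0; apply: ge_ereal_sup => _ [X [finX XP]] <-.
rewrite fsbig_finite //= big_seq -ge0_sume_distrl; last first.
  by move=> i; rewrite in_fset_set // inE => /XP /a0.
apply: lee_wpmul2r => //; rewrite -big_seq -fsbig_finite //.
by apply: esum_ge; exists X.
Qed.

Lemma subset_esum (T : choiceType) (P Q : set T) (a : T -> \bar R) :
  P `<=` Q -> (forall i, Q i -> 0 <= a i) -> \esum_(i in P) a i <= \esum_(i in Q) a i.
Proof.
move=> PQ a0; apply: ge_ereal_sup => _ [X [finX XP]] <-; apply: esum_ge.
by exists X => //; split => //; apply: subset_trans PQ.
Qed.

Lemma esum_inj_le (T T' : choiceType) (e : T -> T') (a : T' -> \bar R) :
  injective e -> (forall j, 0 <= a j) ->
  \esum_(i in [set: T]) a (e i) <= \esum_(j in [set: T']) a j.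
Proof.
move=> einj a0; rewrite -(esum_image setT) => [|x y _ _ /einj //].
exact: subset_esum.
Qed.

Lemma esum_pair (T T' : choiceType) (a : T -> T' -> \bar R) :
  (forall i j, 0 <= a i j) ->
  \esum_(i in [set: T]) \esum_(j in [set: T']) a i j =
  \esum_(k in [set: T * T']) a k.1 k.2.
Proof.
move=> a0; rewrite esum_esum //; congr (esum _ _).
by apply/seteqP; split.
Qed.

Lemma esum_partition (T U : choiceType) (f : T -> U) (a : T -> \bar R) :
  (forall i, 0 <= a i) ->
  \esum_(i in [set: T]) a i = \esum_(k in [set: U]) \esum_(i in [set i | f i = k]) a i.
Proof.
move=> a0; rewrite esum_esum //.
rewrite (reindex_esum [set: T] _ (fun i => (f i, i))) //=.
split=> [i _ //|i j _ _ [] //|[k i] /= [] _ <-].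
by exists i.
Qed.

Lemma esum_geometric (q : R) : (0 <= q < 1)%R ->
  \esum_(n in [set: nat]) (q ^+ n)%:E <= ((1 - q)^-1)%:E.
Proof.
move=> /andP[q0 q1]; rewrite -nneseries_esumT => [|n]; last by rewrite lee_fin exprn_ge0.
apply: lime_le; first by apply: is_cvg_nneseries => n _ _; rewrite lee_fin exprn_ge0.
apply: nearW => n; rewrite sumEFin lee_fin.
rewrite -[leRHS]mul1r ler_pdivlMr ?subr_gt0 // big_mkord mulrC -opprB mulNr -subrX1.
by rewrite opprB gerBl exprn_ge0.
Qed.

Section SeqSums.
Variables (T : choiceType) (w : T -> R) (theta : R).
Hypothesis w0 : forall x, (0 <= w x)%R.
Hypothesis w_le : \esum_(x in [set: T]) (w x)%:E <= theta%:E.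

Lemma total_weight_ge0 : (0 <= theta)%R.
Proof. by rewrite -lee_fin; apply: le_trans w_le; apply: esum_ge0 => x _; rewrite lee_fin. Qed.

Lemma esum_seq_size r :
  \esum_(l in [set l : seq T | size l = r]) (\prod_(x <- l) w x)%:E <= (theta ^+ r)%:E.
Proof.
have p0 l : (0 <= \prod_(x <- l) w x)%R by apply: prodr_ge0.
elim: r => [|r IH].
  rewrite (_ : [set l | _] = [set [::]]); last first.
    by apply/seteqP; split=> [l /= /size0nil //|l /= ->].
  by rewrite esum_set1 big_nil // lee_fin.
rewrite (reindex_esum ([set: T] `*`` (fun=> [set l : seq T | size l = r])) _ (fun k => k.1 :: k.2));
  last first.
  split=> [[x l] /= [_ ->] //|[x l] [y m] _ _ /= [-> ->] //|[//|x l] /= [lr]].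
  by exists (x, l).
rewrite -(@esum_esum _ _ _ [set: T] (fun=> [set l : seq T | size l = r])
  (fun x l => (\prod_(y <- x :: l) w y)%:E)); last by move=> x l _ _; rewrite lee_fin.
apply: (@le_trans _ _ (\esum_(x in [set: T]) ((theta ^+ r)%:E * (w x)%:E))).
  apply: le_esum => x _; under eq_esum do rewrite big_cons EFinM.
  rewrite esumZl //; last by move=> l _; rewrite lee_fin.
  by rewrite muleC lee_wpmul2r // lee_fin.
rewrite esumZl ?exprn_ge0 ?total_weight_ge0 //; last by move=> x _; rewrite lee_fin.
by rewrite exprSr EFinM lee_wpmul2l // lee_fin exprn_ge0 ?total_weight_ge0.
Qed.

(** The generating function of f at theta: lists of length r have total weight
    at most [theta ^+ r]. *)
Lemma esum_seq (f : nat -> R) : (forall r, 0 <= f r)%R ->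
  \esum_(l in [set: seq T]) (f (size l) * \prod_(x <- l) w x)%:E <=
  \esum_(r in [set: nat]) (f r * theta ^+ r)%:E.
Proof.
move=> f0; have p0 l : (0 <= \prod_(x <- l) w x)%R by apply: prodr_ge0.
rewrite (esum_partition (@size T)); last by move=> l; rewrite lee_fin mulr_ge0.
apply: le_esum => r _.
rewrite (eq_esum (b := fun l => (f r)%:E * (\prod_(x <- l) w x)%:E)); last first.
  by move=> l /= ->; rewrite EFinM.
rewrite esumZl //; last by move=> l _; rewrite lee_fin.
by rewrite EFinM lee_wpmul2l ?lee_fin // esum_seq_size.
Qed.

End SeqSums.

End EsumExtra.

(** * An exponential moment of a subcritical law *)

Section ExponentialMoment.
Local Open Scope ereal_scope.
Variable R : realType.

(** Equivalent to [expR x * (1 - x) <= 1] after division by [1 + x]. *)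
Lemma expR_le_quad (x : R) : (0 <= x -> expR x <= 1 + x + x ^+ 2 * expR x)%R.
Proof.
move=> x0; have : (1 - x <= expR (- x))%R by apply: expR_ge1Dx.
move=> /(ler_wpM2r (expR_ge0 x)); rewrite -expRD addNr expR0 => le1.
have /(ler_wpM2r (_ : 0 <= 1 + x)%R) := le1; rewrite addr_ge0 // => /(_ isT).
by nra.
Qed.

Lemma sqr_le_exp (mu : R) (r : nat) : (0 < mu)%R ->
  (r%:R ^+ 2 <= mu ^- 2 * expR (2 * mu * r%:R))%R.
Proof.
move=> mu0; have x0 : (0 <= mu * r%:R)%R by rewrite mulr_ge0 // ltW.
have le1 : (mu * r%:R <= expR (mu * r%:R))%R.
  by apply: le_trans (expR_ge1Dx _); rewrite lerDr.
rewrite (_ : r%:R ^+ 2 = mu ^- 2 * (mu * r%:R) ^+ 2)%R; last first.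
  by rewrite exprMn mulrA mulVf ?mul1r // expf_neq0 // gt_eqF.
apply: ler_wpM2l; first by rewrite invr_ge0 exprn_ge0 // ltW.
rewrite (_ : 2 * mu * r%:R = mu * r%:R + mu * r%:R)%R; last by ring.
by rewrite expRD expr2 ler_pM.
Qed.

(** The generating function g of p satisfies g(1) = 1 and g'(1) < 1, so g(s) < s
    for some s > 1 close to 1.  With s = e^lam, the bound
    g(e^lam) <= 1 + lam m + O(lam^2), where m is the mean, makes this explicit
    and yields a ratio s / g(s) = e^c > 1. *)
Lemma subcritical_exponent (p : nat -> R) (a : R) :
  (0 < a)%R -> (forall r, 0 <= p r)%R -> \esum_(r in [set: nat]) (p r)%:E = 1 ->
  \esum_(r in [set: nat]) (r%:R * p r)%:E < 1 ->
  (forall r, p r <= expR (- (a * r%:R)))%R ->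
  exists lam c : R, [/\ (0 < lam <= a / 4)%R, (0 < c)%R &
    \esum_(r in [set: nat]) (p r * expR lam ^+ r)%:E <= (expR (lam - c))%:E].
Proof.
move=> a0 p0 p1 pm pa.
have [m mE] : exists m : R, \esum_(r in [set: nat]) (r%:R * p r)%:E = m%:E.
  exists (fine (\esum_(r in [set: nat]) (r%:R * p r)%:E)); rewrite fineK //.
  rewrite ge0_fin_numE; first exact: lt_trans pm (ltry _).
  by apply: esum_ge0 => r _; rewrite lee_fin mulr_ge0.
have m0 : (0 <= m)%R by rewrite -lee_fin -mE; apply: esum_ge0 => r _; rewrite lee_fin mulr_ge0.
have m1 : (m < 1)%R by rewrite -lte_fin -mE.
pose q := expR (- (a / 2)).
have q01 : (0 <= q < 1)%R by rewrite expR_ge0 expR_lt1 oppr_lt0 divr_gt0.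
pose Q := (1 - q)^-1%R.
have Q0 : (0 < Q)%R by rewrite invr_gt0 subr_gt0; case/andP: q01.
have sQ : \esum_(r in [set: nat]) (p r * expR (a / 2 * r%:R))%:E <= Q%:E.
  apply: le_trans (esum_geometric q01); apply: le_esum => r _; rewrite lee_fin.
  apply: (le_trans (ler_wpM2r (expR_ge0 _) (pa r))).
  rewrite -expRD -expRM_natr le_eqVlt; apply/orP; left; apply/eqP; congr expR.
  by rewrite mulNr {1}(splitr a) mulrDl opprD subrK.
pose K := ((a / 8) ^- 2)%R.
have K0 : (0 < K)%R by rewrite invr_gt0 exprn_gt0 // divr_gt0.
pose lam := Num.min (a / 4)%R ((1 - m) / (2 * K * Q))%R.
have lam0 : (0 < lam)%R.
  by rewrite lt_min divr_gt0 //= divr_gt0 ?subr_gt0 // !mulr_gt0.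
have lam1 : (lam <= a / 4)%R by rewrite ge_min lexx.
have lam2 : (lam * (2 * K * Q) <= 1 - m)%R.
  by rewrite -ler_pdivlMr ?mulr_gt0 // ge_min lexx orbT.
(* lam is small enough for the quadratic term to be at most half of
   lam * (1 - m), so that y < 1 + lam <= expR lam *)
pose y := (1 + lam * m + lam ^+ 2 * K * Q)%R.
have y0 : (0 < y)%R.
  by rewrite /y -addrA ltr_wpDr // addr_ge0 // !mulr_ge0 ?exprn_ge0 // ltW.
have ylam : (y < expR lam)%R.
  apply: lt_le_trans (expR_ge1Dx _); rewrite /y -addrA ltrD2l expr2.
  by nra.
exists lam, (lam - ln y)%R; split; first by rewrite lam0.
  by rewrite subr_gt0 -ltr_expR lnK.
rewrite opprB addrCA subrr addr0 lnK ?posrE //.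
apply: (@le_trans _ _ (\esum_(r in [set: nat]) ((p r)%:E + (lam%:E * (r%:R * p r)%:E +
    (lam ^+ 2 * K)%:E * (p r * expR (a / 2 * r%:R))%:E)))).
  apply: le_esum => r _; rewrite -!EFinM -!EFinD lee_fin -expRM_natr.
  have := expR_le_quad (_ : 0 <= lam * r%:R)%R; rewrite mulr_ge0 ?(ltW lam0) // => /(_ isT) le1.
  apply: (le_trans (ler_wpM2l (p0 r) le1)).
  rewrite mulrDr mulrDr mulr1 -addrA lerD2l; apply: lerD.
    by rewrite mulrCA (mulrC (p r)).
  have le2 : (r%:R ^+ 2 * expR (lam * r%:R) <= K * expR (a / 2 * r%:R))%R.
    have := @sqr_le_exp (a / 8) r; rewrite divr_gt0 // => /(_ isT).
    move=> /(ler_wpM2r (expR_ge0 (lam * r%:R))) /le_trans; apply.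
    rewrite -/K -(mulrA K) ler_wpM2l ?(ltW K0) // -expRD ler_expR -mulrDl ler_wpM2r //.
    by lra.
  have /(ler_wpM2l (_ : 0 <= p r * lam ^+ 2)%R) := le2.
  rewrite mulr_ge0 ?exprn_ge0 ?(ltW lam0) // => /(_ isT) le3.
  rewrite exprMn; lra.
have n1 r : 0 <= (p r)%:E by rewrite lee_fin.
have n2 r : 0 <= (r%:R * p r)%:E by rewrite lee_fin mulr_ge0.
have n3 r : 0 <= (p r * expR (a / 2 * r%:R))%:E by rewrite lee_fin mulr_ge0 ?expR_ge0.
have l2 : (0 <= lam ^+ 2 * K)%R by rewrite mulr_ge0 ?exprn_ge0 ?ltW.
rewrite esumD; last 2 first.
- by move=> r _.
- by move=> r _; rewrite adde_ge0 // mule_ge0 // lee_fin // ltW.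
rewrite esumD; last 2 first.
- by move=> r _; rewrite mule_ge0 // lee_fin ltW.
- by move=> r _; rewrite mule_ge0 // lee_fin.
rewrite p1 !esumZl ?(ltW lam0) // mE /y EFinD EFinD EFinM -addeA; do 2 apply: leeD => //.
by rewrite [leRHS]EFinM lee_wpmul2l // lee_fin.
Qed.

End ExponentialMoment.

(** * Sums weighted by the Galton-Watson mass *)

Lemma prod_expr_sum (R : comNzRingType) (I : Type) (r : seq I) (f : I -> R) (z : R) (k : I -> nat) :
  \prod_(x <- r) (f x * z ^+ k x) = (\prod_(x <- r) f x) * z ^+ (\sum_(x <- r) k x).
Proof.
elim: r => [|x r IH]; first by rewrite !big_nil mulr1.
by rewrite !big_cons IH exprD mulrACA.
Qed.

Lemma prodZ_seq (R : comNzRingType) (I : Type) (r : seq I) (f : I -> R) (b : R) :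
  \prod_(x <- r) (b * f x) = b ^+ size r * \prod_(x <- r) f x.
Proof.
elim: r => [|x r IH]; first by rewrite !big_nil mulr1.
by rewrite !big_cons IH exprS mulrACA.
Qed.

Section GaltonWatsonSums.
Local Open Scope ereal_scope.
Variables (R : realType) (h : probability nat R).

Definition offspring (r : nat) : R := fine (h [set r]).

Lemma offspring_ge0 r : (0 <= offspring r)%R.
Proof. exact: fine_ge0. Qed.

Lemma gw_mass_ge0 t : (0 <= gw_mass h t)%R.
Proof. by apply: prodr_ge0 => u _; exact: fine_ge0. Qed.

Lemma gw_mass_node l :
  gw_mass h (node l) = (offspring (size l) * \prod_(x <- l) gw_mass h x)%R.
Proof.
rewrite /gw_mass big_node nchildren_node_root; congr (_ * _)%R.
rewrite [RHS](big_nth root_tree) /index_iota subn0.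
apply: eq_big_seq => q; rewrite mem_iota /= add0n => ql.
by apply: eq_big_seq => v vx; rewrite nchildren_node_cons.
Qed.

Lemma gw_mass_root : gw_mass h root_tree = offspring 0.
Proof. by rewrite -node_nil gw_mass_node big_nil mulr1. Qed.

Lemma gw_mass_plant g t :
  gw_mass h (plant g t) = (offspring g.+1 * offspring 0 ^+ g * gw_mass h t)%R.
Proof.
rewrite gw_mass_node /= size_nseq big_cons.
rewrite (eq_big_seq (fun=> offspring 0 * 1)%R); last first.
  by move=> y /nseqP[-> _]; rewrite gw_mass_root mulr1.
by rewrite prodZ_seq size_nseq big1_eq mulr1; ring.
Qed.

Lemma card_tree_gt0 t : (0 < #|` tree_fset t|)%N.
Proof. by rewrite cardfs_gt0; apply/fset0Pn; exists [::]; exact: tree_root. Qed.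

Lemma esum_rtree (H : rtree -> \bar R) :
  \esum_(t in [set: rtree]) H t = \esum_(l in [set: seq rtree]) H (node l).
Proof.
apply: reindex_esum; split=> [//|l m _ _ /node_inj //|t _].
by exists (kids t); rewrite ?kidsK.
Qed.

Section Moment.
Variables (z s : R).
Hypotheses (z0 : (0 <= z)%R) (s0 : (0 <= s)%R).
Hypothesis pz : \esum_(r in [set: nat]) (z * offspring r * s ^+ r)%:E <= s%:E.

(** Let s be such that z g(s) <= s, with g the generating function of the
    offspring law.  Decomposing a tree at its root, the sum restricted to trees
    of size at most n + 1 is at most z g applied to the sum restricted to size
    at most n, hence stays below s. *)
Lemma esum_card_moment :
  \esum_(t in [set: rtree]) (gw_mass h t * z ^+ #|` tree_fset t|)%:E <= s%:E.
Proof.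
pose w n x := (if (#|` tree_fset x| <= n)%N then gw_mass h x * z ^+ #|` tree_fset x| else 0)%R.
have w0 n x : (0 <= w n x)%R.
  by rewrite /w; case: ifP => // _; rewrite mulr_ge0 ?exprn_ge0 ?gw_mass_ge0.
have wn n : \esum_(t in [set: rtree]) (w n t)%:E <= s%:E.
  elim: n => [|n IH].
    rewrite esum1 ?lee_fin // => t _; rewrite /w leqn0.
    by rewrite -[_ == 0%N]negbK -lt0n card_tree_gt0.
  apply: le_trans pz; rewrite esum_rtree.
  apply: le_trans (esum_seq (w0 n) IH (f := fun r => z * offspring r)%R _).
    apply: le_esum => l _; rewrite lee_fin [leLHS]/w; case: ifP; last first.
      by move=> _; rewrite mulr_ge0 ?prodr_ge0 ?mulr_ge0 ?offspring_ge0.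
    rewrite card_node ltnS => ln; rewrite gw_mass_node exprS.
    rewrite [X in (_ <= _ * X)%R](eq_big_seq (fun x => gw_mass h x * z ^+ #|` tree_fset x|)%R).
      by rewrite prod_expr_sum le_eqVlt; apply/orP; left; apply/eqP; ring.
    by move=> x xl; rewrite /w ifT //; apply: leq_trans ln; rewrite (big_rem x) //= leq_addr.
  by move=> r; rewrite mulr_ge0 // offspring_ge0.
apply: ge_ereal_sup => _ [X [finX _]] <-.
pose n := (\max_(t <- fset_set X) #|` tree_fset t|)%N.
apply: le_trans (wn n); apply: esum_ge; exists X => //.
rewrite !fsbig_finite //= !big_seq; apply: lee_sum => t tX.
by rewrite /w ifT // /n (big_rem t) //= leq_maxl.
Qed.

End Moment.

(** A tree of positive depth is the same thing as a deepest subtree together with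
    its lists of left and right siblings. *)
Lemma esum_deepest_split (H : rtree -> \bar R) : (forall t, 0 <= H t) ->
  \esum_(t in [set t | (0 < depth t)%N]) H t =
  \esum_(ll in [set: seq rtree * seq rtree]) \esum_(x in [set: rtree])
     (if deepest_split ll.1 x ll.2 then H (node (ll.1 ++ x :: ll.2)) else 0).
Proof.
move=> H0; rewrite (esum_pair (a := fun ll x =>
   if deepest_split ll.1 x ll.2 then H (node (ll.1 ++ x :: ll.2)) else 0)); last first.
  by move=> ll x; case: ifP.
pose D := [set k : (seq rtree * seq rtree) * rtree | deepest_split k.1.1 k.2 k.1.2].
transitivity (\esum_(k in D) H (node (k.1.1 ++ k.2 :: k.1.2))); last first.
  rewrite esum_mkcond; apply: eq_esum => k _.
  by have -> : (k \in D) = deepest_split k.1.1 k.2 k.1.2 by apply/idP/idP; rewrite inE.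
apply: reindex_esum; split.
- by move=> [[l1 l2] x] /= ds; rewrite depth_node_split.
- move=> [[l1 l2] x] [[m1 m2] y]; rewrite !inE /D /= => ds ds' /node_inj e.
  have sz : size l1 = size m1 by rewrite -(deepest_split_uniq ds) e deepest_split_uniq.
  by move: e => /eqP; rewrite eqseq_cat // eqseq_cons => /and3P[/eqP -> /eqP -> /eqP ->].
- move=> t /= t0; have l0 := kids_neq0 t0.
  exists (take (argdeep (kids t)) (kids t), drop (argdeep (kids t)).+1 (kids t),
    nth root_tree (kids t) (argdeep (kids t))).
    exact: argdeepP.
  by rewrite /= argdeep_split // kidsK.
Qed.

Section Pruning.
Variables (g : nat) (z s b : R).
Hypotheses (z0 : (0 < z)%R) (b0 : (0 <= b)%R).
Hypothesis p0 : (0 < offspring 0)%R.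
Hypothesis pg : (0 < offspring g.+1)%R.
Hypothesis pb : forall r, (offspring r.+1 <= b ^+ r)%R.
Hypothesis bs : (b * s < 1)%R.
Hypothesis moment : \esum_(t in [set: rtree]) (gw_mass h t * z ^+ #|` tree_fset t|)%:E <= s%:E.

Let z0' : (0 <= z)%R := ltW z0.

Let w x := (b * (gw_mass h x * z ^+ #|` tree_fset x|))%R.

Let w0 x : (0 <= w x)%R.
Proof. by rewrite !mulr_ge0 ?gw_mass_ge0 ?exprn_ge0. Qed.

Let s0 : (0 <= s)%R.
Proof.
by rewrite -lee_fin; apply: le_trans moment; apply: esum_ge0 => t _;
  rewrite lee_fin mulr_ge0 ?gw_mass_ge0 ?exprn_ge0.
Qed.

(** In the fraction, z accounts for the spine vertex, the two inverses for the
    siblings on each side, and the denominator for the new leaves. *)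
Definition prune_const : R :=
  (z * ((1 - b * s)^-1 * (1 - b * s)^-1) / (offspring g.+1 * offspring 0 ^+ g))%R.

Lemma prune_const_ge0 : (0 <= prune_const)%R.
Proof.
have Q0 : (0 <= 1 - b * s)%R by rewrite subr_ge0 ltW.
by rewrite divr_ge0 ?mulr_ge0 ?invr_ge0 ?exprn_ge0 ?offspring_ge0.
Qed.

(** The factor b in w comes from bounding the offspring law by a geometric
    sequence; it makes the number of siblings summable. *)
Lemma esum_siblings :
  \esum_(ll in [set: seq rtree * seq rtree]) (\prod_(x <- ll.1) w x * \prod_(x <- ll.2) w x)%:E
   <= ((1 - b * s)^-1 * (1 - b * s)^-1)%:E.
Proof.
have p_ge0 l : (0 <= \prod_(x <- l) w x)%R by apply: prodr_ge0.
have wle : \esum_(x in [set: rtree]) (w x)%:E <= (b * s)%:E.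
  rewrite /w; under eq_esum do rewrite EFinM.
  rewrite esumZl //; last by move=> x _; rewrite lee_fin mulr_ge0 ?gw_mass_ge0 ?exprn_ge0.
  by rewrite [leRHS]EFinM lee_wpmul2l ?lee_fin.
have sw : \esum_(l in [set: seq rtree]) (\prod_(x <- l) w x)%:E <= ((1 - b * s)^-1)%:E.
  have bs01 : (0 <= b * s < 1)%R by apply/andP; split; [exact: mulr_ge0|].
  apply: le_trans (esum_geometric bs01).
  have e := @esum_seq _ _ _ _ w0 wle (fun=> 1%R) (fun=> ler01).
  apply: le_trans (le_trans e _); apply: le_esum => l _; rewrite mul1r //.
rewrite -(esum_pair (a := fun l m => (\prod_(x <- l) w x * \prod_(x <- m) w x)%:E)); last first.
  by move=> l m; rewrite lee_fin mulr_ge0.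
set Q := ((1 - b * s)^-1)%R.
have Q0 : (0 <= Q)%R by rewrite invr_ge0 subr_ge0 (ltW bs).
apply: (@le_trans _ _ (\esum_(l in [set: seq rtree]) (Q%:E * (\prod_(x <- l) w x)%:E))).
  apply: le_esum => l _; under eq_esum do rewrite EFinM.
  rewrite esumZl //; last by move=> m _; rewrite lee_fin.
  by rewrite muleC lee_wpmul2r // lee_fin.
rewrite esumZl //; last by move=> m _; rewrite lee_fin.
by rewrite EFinM lee_wpmul2l ?lee_fin.
Qed.

Lemma gw_mass_split l1 x l2 : gw_mass h (node (l1 ++ x :: l2)) =
  (offspring (size l1 + size l2).+1 * \prod_(y <- l1 ++ l2) gw_mass h y * gw_mass h x)%R.
Proof.
rewrite gw_mass_node size_cat /= addnS -mulrA; congr (_ * _)%R.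
by rewrite !big_cat big_cons /= mulrCA mulrC.
Qed.

(** Induction on i.  At i = 0 the siblings of the spine child are summed out.  At
    i + 1, the siblings at the root are fixed and the case i is applied to the
    spine child, with F precomposed by the insertion among these siblings; the
    condition that the split be at the deepest child can be included in F,
    because pruning preserves the depth. *)
Lemma esum_prune i (F : rtree -> \bar R) : (forall t, 0 <= F t) ->
  \esum_(t in [set t | (i < depth t)%N]) ((gw_mass h t * z ^+ outgrowth_size i t)%:E * F (prune g i t))
  <= prune_const%:E * \esum_(t in [set: rtree]) ((gw_mass h t)%:E * F t).
Proof.
have m0 := gw_mass_ge0.
have pw0 (t : rtree) n : (0 <= gw_mass h t * z ^+ n)%R by rewrite mulr_ge0 ?exprn_ge0.
elim: i F => [|i IH] F F0.
  rewrite esum_deepest_split; last by move=> t; rewrite mule_ge0 // lee_fin.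
  pose SF := \esum_(t in [set: rtree]) ((gw_mass h t)%:E * F t); rewrite -/SF.
  pose H x := (gw_mass h x)%:E * F (plant g x).
  have H0 x : 0 <= H x by rewrite mule_ge0 // lee_fin.
  have HF : ((offspring g.+1 * offspring 0 ^+ g)%:E * (\esum_(x in [set: rtree]) H x) <= SF)%E.
    rewrite -esumZl //; last by rewrite mulr_ge0 ?exprn_ge0 // ltW.
    apply: le_trans (esum_inj_le (a := fun t => (gw_mass h t)%:E * F t) (@plant_inj g) _); last first.
      by move=> t; rewrite mule_ge0 // lee_fin.
    apply: le_esum => x _; rewrite /H muleA -EFinM; apply: lee_wpmul2r => //.
    by rewrite gw_mass_plant.
  apply: (@le_trans _ _ ((z * ((1 - b * s)^-1 * (1 - b * s)^-1))%:E * \esum_(x in [set: rtree]) H x)).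
    apply: (@le_trans _ _ (\esum_(ll in [set: seq rtree * seq rtree])
       (z%:E * (\prod_(x <- ll.1) w x * \prod_(x <- ll.2) w x)%:E) * \esum_(x in [set: rtree]) H x)).
      apply: le_esum => -[l1 l2] _ /=.
      rewrite -EFinM -esumZl //; last by rewrite !mulr_ge0 ?prodr_ge0.
      apply: le_esum => x _; case: ifP => ds; last first.
        by rewrite mule_ge0 // lee_fin !mulr_ge0 ?prodr_ge0.
      rewrite prune0_split // muleA -EFinM; apply: lee_wpmul2r => //.
      rewrite lee_fin outgrowth_size0_split // gw_mass_split -big_cat /= /w prodZ_seq prod_expr_sum.
      rewrite exprS size_cat.
      set V := (\prod_(y <- l1 ++ l2) gw_mass h y)%R.
      set Z := (z ^+ _)%R.
      have V0 : (0 <= V)%R by apply: prodr_ge0.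
      have Z0 : (0 <= Z)%R by apply: exprn_ge0.
      have VZ0 : (0 <= V * gw_mass h x * (z * Z))%R by rewrite !mulr_ge0.
      have := ler_wpM2r VZ0 (pb (size l1 + size l2)).
      by lra.
    apply: le_trans (esumZr_le _ _) _; [|by apply: esum_ge0|].
      by move=> ll _; rewrite mule_ge0 ?lee_fin ?mulr_ge0 ?prodr_ge0.
    apply: lee_wpmul2r; first exact: esum_ge0.
    rewrite esumZl // => [|ll _]; last by rewrite lee_fin mulr_ge0 ?prodr_ge0.
    by rewrite EFinM lee_wpmul2l ?lee_fin // esum_siblings.
  have D0 : (0 < offspring g.+1 * offspring 0 ^+ g)%R by rewrite mulr_gt0 ?exprn_gt0.
  rewrite /prune_const [X in _ <= X * _]EFinM -[leRHS]muleA; apply: lee_wpmul2l.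
    by rewrite lee_fin !mulr_ge0 // invr_ge0 subr_ge0 ltW.
  have D1 : 0 <= ((offspring g.+1 * offspring 0 ^+ g)^-1)%:E by rewrite lee_fin invr_ge0 ltW.
  have := lee_wpmul2l D1 HF.
  by rewrite muleA -EFinM mulVf ?mul1e // gt_eqF.
pose T t := (gw_mass h t * z ^+ outgrowth_size i.+1 t)%:E * F (prune g i.+1 t).
have T0 t : 0 <= T t by rewrite mule_ge0 // lee_fin.
apply: (@le_trans _ _ (\esum_(t in [set t | (0 < depth t)%N])
    (if (i.+1 < depth t)%N then T t else 0))).
  rewrite esum_mkcond [leRHS]esum_mkcond; apply: le_esum => t _.
  case: ifPn => [|_]; last by case: ifP => // _; case: ifP.
  by rewrite inE => it; rewrite mem_set ?it //=; exact: leq_trans it.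
rewrite esum_deepest_split; last by move=> t; case: ifP.
pose B (ll : seq rtree * seq rtree) :=
  (offspring (size ll.1 + size ll.2).+1 * \prod_(y <- ll.1 ++ ll.2) gw_mass h y)%R.
have B0 ll : (0 <= B ll)%R by rewrite mulr_ge0 ?prodr_ge0 ?offspring_ge0.
pose G ll y := if deepest_split ll.1 y ll.2 then F (node (ll.1 ++ y :: ll.2)) else 0.
have G0 ll y : 0 <= G ll y by rewrite /G; case: ifP.
apply: (@le_trans _ _ (\esum_(ll in [set: seq rtree * seq rtree]) ((B ll)%:E *
   (prune_const%:E * \esum_(y in [set: rtree]) ((gw_mass h y)%:E * G ll y))))).
  apply: le_esum => ll _.
  have Bll0 : 0 <= (B ll)%:E by rewrite lee_fin.
  apply: le_trans (lee_wpmul2l Bll0 (IH (G ll) (G0 ll))).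
  rewrite -esumZl //; last by move=> x _; rewrite mule_ge0 // lee_fin.
  rewrite [leRHS]esum_mkcond; apply: le_esum => x _.
  case: ifPn => [ds|_]; last first.
    by case: ifP => // _; rewrite !mule_ge0 // lee_fin.
  rewrite depth_node_split // ltnS; case: ifPn => ix; last first.
    by case: ifP => // _; rewrite !mule_ge0 // lee_fin.
  rewrite mem_set //= /T /G outgrowth_sizeS_split // pruneS_split //.
  have -> : deepest_split ll.1 (prune g i x) ll.2 by rewrite /deepest_split depth_prune.
  by rewrite gw_mass_split muleA -EFinM /B mulrA.
rewrite (eq_esum (b := fun ll => prune_const%:E *
   ((B ll)%:E * \esum_(y in [set: rtree]) ((gw_mass h y)%:E * G ll y)))); last first.
  by move=> ll _; rewrite muleCA.
have sG0 ll : 0 <= (B ll)%:E * \esum_(y in [set: rtree]) ((gw_mass h y)%:E * G ll y).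
  by rewrite mule_ge0 ?lee_fin // esum_ge0 // => y _; rewrite mule_ge0 // lee_fin.
rewrite esumZl ?prune_const_ge0 //; apply: lee_wpmul2l; first by rewrite lee_fin prune_const_ge0.
pose U t := (gw_mass h t)%:E * F t.
have U0 t : 0 <= U t by rewrite mule_ge0 // lee_fin.
apply: (@le_trans _ _ (\esum_(t in [set t | (0 < depth t)%N]) U t)); last exact: subset_esum.
rewrite esum_deepest_split //; apply: le_esum => ll _.
rewrite -esumZl //; last by move=> x _; rewrite mule_ge0 // lee_fin.
apply: le_esum => y _; rewrite /G; case: ifP => ds; last by rewrite !mule0.
by rewrite /U gw_mass_split muleA -EFinM /B.
Qed.

End Pruning.

End GaltonWatsonSums.

(** * The support of the bias law and the offspring law *)

Section Support.
Local Open Scope ereal_scope.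
Variables (R : realType) (nu : probability (measurableTypeR R) R).

(** Each point of A has a null open neighbourhood, and finitely many of these
    cover A. *)
Lemma compact_null (A : set R) : compact A -> measurable (A : set (measurableTypeR R)) ->
  A `&` msupport nu = set0 -> nu A = 0.
Proof.
move=> cA mA A0.
have /choice[f fP] : forall x : R, exists U : set R,
    [/\ open U, nu U = 0 & A x -> U x].
  move=> x; have [Ax|nAx] := pselect (A x); last first.
    by exists set0; split => //; exact: open0.
  have : ~ msupport nu x by move=> sx; suff : set0 x by []; rewrite -A0.
  move=> /existsNP[U /not_implyP[oU /not_implyP[Ux nU]]].
  exists U; split => //; apply/eqP; rewrite eq_le measure_ge0 andbT leNgt.
  exact/negP.
have mf x : measurable (f x : set (measurableTypeR R)).
  by have [oF _ _] := fP x; exact: measurable_realfun.open_measurable.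
move: cA; rewrite compact_cover => /(_ _ setT f) [|x Ax|D _ AD].
- by move=> x _; have [] := fP x.
- by exists x => //; have [_ _] := fP x; apply.
apply/eqP; rewrite eq_le measure_ge0 andbT.
apply: (@le_trans _ _ (nu (\big[setU/set0]_(x <- D) f x))).
  apply: le_measure; rewrite ?inE //; first by apply: bigsetU_measurable.
  by rewrite -bigcup_seq.
apply: le_trans (union_bound (c := 0) mf _) _; last by rewrite mule0.
by move=> x _; have [_ e _] := fP x; rewrite le_eqVlt; apply/orP; left; apply/eqP; exact: e.
Qed.

Hypothesis nu_gt1 : msupport nu `<=` `]1%R, +oo[.

(** The complement is a countable union of segments that avoid the support. *)
Lemma nu_itv1 : nu `]1%R, +oo[%classic = 1.
Proof.
have m1 : measurable (`]-oo, 1%R]%classic : set (measurableTypeR R)) by exact: measurable_itv.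
have -> : `]1%R, +oo[%classic = ~` (`]-oo, 1%R]%classic : set R).
  by apply/seteqP; split=> x /=; rewrite !in_itv /= ?andbT ltNge => /negP.
rewrite probability_setC // [X in _ - X](_ : _ = 0) ?sube0 //.
apply/eqP; rewrite eq_le measure_ge0 andbT.
have m2 n : measurable (`[(- n%:R)%R, 1%R]%classic : set (measurableTypeR R)) by exact: measurable_itv.
have -> : `]-oo, 1%R]%classic = \bigcup_n (`[(- n%:R)%R, 1%R]%classic : set R).
  apply/seteqP; split=> [x|x [n _]] /=; rewrite !in_itv /=; last by case/andP.
  move=> x1.
  exists (Num.bound `|x|%R) => //=; rewrite in_itv /= x1 andbT.
  by rewrite lerNl (le_trans _ (ltW (archi_boundP (normr_ge0 x)))) // -normrN ler_norm.
apply: le_trans (generalized_Boole_inequality _ _ _) _ => //.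
  exact: bigcup_measurable.
rewrite eseries0 // => n _ _; apply: compact_null => //; first exact: segment_compact.
apply/seteqP; split=> x //= -[xI /nu_gt1]; move: xI; rewrite /= !in_itv /= andbT.
by move=> /andP[_ x1]; rewrite ltNge x1.
Qed.

Lemma nu_rho : exists2 rho : R, (1 < rho)%R & 0 < nu `[rho, +oo[%classic.
Proof.
apply: contrapT => no.
have n0 n : nu `[(1 + n.+1%:R^-1)%R, +oo[%classic = 0.
  apply/eqP; rewrite eq_le measure_ge0 andbT leNgt; apply/negP => n0.
  by apply: no; exists (1 + n.+1%:R^-1)%R => //; rewrite ltrDl invr_gt0.
have : nu `]1%R, +oo[%classic <= 0.
  have m2 n : measurable (`[(1 + n.+1%:R^-1)%R, +oo[%classic : set (measurableTypeR R)).
    exact: measurable_itv.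
  have -> : `]1%R, +oo[%classic = \bigcup_n (`[(1 + n.+1%:R^-1)%R, +oo[%classic : set R).
    apply/seteqP; split=> [x|x [n _]] /=; rewrite !in_itv /= !andbT; last first.
      by apply: lt_le_trans; rewrite ltrDl invr_gt0.
    move=> x1.
    have x0 : (0 < x - 1)%R by rewrite subr_gt0.
    exists (Num.bound (x - 1)^-1) => //=; rewrite in_itv /= andbT -lerBrDl.
    rewrite invf_ple ?posrE //; apply/ltW.
    apply: lt_le_trans (archi_boundP _) _; first by rewrite invr_ge0 ltW.
    by rewrite ler_nat.
  apply: le_trans (generalized_Boole_inequality _ _ _) _ => //.
    exact: bigcup_measurable.
  by rewrite eseries0 // => n _ _; exact: n0.
by rewrite nu_itv1 leNgt lte01.
Qed.

End Support.

Section Offspring.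
Local Open Scope ereal_scope.
Variables (R : realType) (h : probability nat R).

Lemma offspringE r : (offspring h r)%:E = h [set r].
Proof. by rewrite /offspring fineK // fin_num_measure. Qed.

Lemma esum_offspring : \esum_(r in [set: nat]) (offspring h r)%:E = 1.
Proof.
under eq_esum do rewrite offspringE.
rewrite -nneseries_esumT // -(probability_setT h).
rewrite (_ : [set: nat] = \bigcup_(n in [set: nat]) [set n]); last first.
  by apply/seteqP; split=> n // _; exists n.
rewrite measure_bigcup //.
  by apply: eq_eseriesl => n; rewrite in_setT.
by apply/trivIsetP => i j _ _ ij; apply/seteqP; split=> x //= -[-> e]; rewrite e eqxx in ij.
Qed.

Lemma esum_offspring_mean : \sum_(1 <= k <oo) k%:R%:E * h [set k] < 1 ->
  \esum_(r in [set: nat]) (r%:R * offspring h r)%:E < 1.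
Proof.
under eq_esum do rewrite EFinM offspringE.
rewrite -nneseries_esumT; last by move=> n; rewrite mule_ge0 // lee_fin.
rewrite (nneseries_recl (P := xpredT)) //; last by move=> n _; rewrite mule_ge0 // lee_fin.
by rewrite mul0e add0e.
Qed.

Lemma offspring_le_exp (a : R) : (0 < a)%R ->
  (forall k : nat, (1 <= k)%N -> \sum_(k <= l <oo) h [set l] <= (expR (- (a * k%:R)))%:E) ->
  forall r, (offspring h r <= expR (- (a * r%:R)))%R.
Proof.
move=> a0 ha [|r].
  by rewrite mulr0 oppr0 expR0 -lee_fin offspringE probability_le1.
rewrite -lee_fin offspringE; apply: le_trans (ha r.+1 isT).
apply: le_trans (nneseries_lim_ge r.+2 _); last by [].
by rewrite big_nat1.
Qed.

Lemma offspring0_gt0 : \esum_(r in [set: nat]) (r%:R * offspring h r)%:E < 1 ->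
  (0 < offspring h 0)%R.
Proof.
move=> mean; rewrite lt_neqAle offspring_ge0 andbT eq_sym; apply/eqP => p0.
move: mean; apply/negP; rewrite -leNgt -esum_offspring; apply: le_esum => -[|r] _.
  by rewrite p0 mulr0.
by rewrite lee_fin ler_peMl ?offspring_ge0 // ler1n.
Qed.

End Offspring.

(** * Comparing the weight tail at two levels *)

Section Growth.
Variable R : realType.

Lemma expr_ge_1Dn (x : R) n : 0 <= x -> 1 + n%:R * x <= (1 + x) ^+ n.
Proof.
move=> x0; elim: n => [|n IH]; first by rewrite mul0r addr0 expr0.
have x1 : 0 <= 1 + x by rewrite addr_ge0.
rewrite exprS; apply: le_trans (ler_wpM2l x1 IH).
rewrite -natr1; have : 0 <= n%:R * x ^+ 2 by rewrite mulr_ge0 ?exprn_ge0.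
by rewrite expr2; lra.
Qed.

(** The number m of steps is chosen as m0 + n %/ L, where L is so large that a
    factor B every L units costs less than exp(eta n).  Linear growth of powers
    of rho is enough. *)
Lemma subexponential_growth (rho B eta : R) : 1 < rho -> 1 <= B -> 0 < eta ->
  exists2 C : R, 0 < C &
    forall n : nat, exists m, n%:R <= rho ^+ m /\ B ^+ m <= C * expR (eta * n%:R).
Proof.
move=> rho1 B1 eta0; have e0 : 0 < rho - 1 by rewrite subr_gt0.
have B0 : 0 < B by apply: lt_le_trans B1.
have Be0 : 0 <= B / eta by apply: divr_ge0; exact: ltW.
pose L := Num.bound (B / eta).
have LB : B <= expR (eta * L%:R).
  apply: le_trans (expR_ge1Dx _); rewrite -[leLHS]add0r; apply: lerD => //.
  by rewrite -ler_pdivrMl // mulrC ltW // archi_boundP.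
have L0 : (0 < L)%N.
  by rewrite -(ltr_nat R); apply: le_lt_trans (archi_boundP Be0).
(* X is at least L and X * (rho - 1) is at least L, whence
   n <= L * (q + 1) <= X * (1 + q * (rho - 1)) for q = n %/ L *)
pose X := L%:R * (1 + (rho - 1)^-1).
have X0 : 0 <= X by rewrite mulr_ge0 // addr_ge0 // invr_ge0 ltW.
have Xr0 : 0 <= X / (rho - 1) by apply: divr_ge0 => //; exact: ltW.
pose m0 := Num.bound (X / (rho - 1)).
have Xm : X <= rho ^+ m0.
  rewrite -[rho](subrKC 1); apply: le_trans (expr_ge_1Dn _ (ltW e0)).
  rewrite -[leLHS]add0r; apply: lerD => //.
  by rewrite -ler_pdivrMr // ltW // archi_boundP.
exists (B ^+ m0); first exact: exprn_gt0.
move=> n; exists (m0 + n %/ L)%N; rewrite !exprD; set q := (n %/ L)%N; split; last first.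
  apply: ler_wpM2l; first by rewrite exprn_ge0 // ltW.
  have : B ^+ q <= expR (eta * L%:R) ^+ q.
    by apply: lerXn2r; rewrite ?nnegrE ?expR_ge0 // ltW.
  move=> /le_trans; apply; rewrite -expRM_natr ler_expR -mulrA ler_wpM2l ?(ltW eta0) //.
  by rewrite -natrM ler_nat mulnC leq_divM.
have nL : n%:R <= L%:R * (q%:R + 1) :> R.
  by rewrite natr1 -natrM ler_nat mulnC ltnW // ltn_ceil.
apply: (le_trans nL); apply: (@le_trans _ _ (X * (1 + q%:R * (rho - 1)))).
  have -> : X * (1 + q%:R * (rho - 1)) = L%:R * (1 + (rho - 1)^-1 + q%:R * (rho - 1) + q%:R).
    by rewrite /X; field; rewrite gt_eqF.
  apply: ler_wpM2l => //.
  have : 0 <= (rho - 1)^-1 by rewrite invr_ge0 ltW.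
  have : 0 <= q%:R * (rho - 1) by rewrite mulr_ge0 // ltW.
  by lra.
have q1 : 1 + q%:R * (rho - 1) <= rho ^+ q.
  by rewrite -[X in _ <= X ^+ _](subrKC 1 rho); apply: expr_ge_1Dn; exact: ltW.
apply: ler_pM => //; by rewrite addr_ge0 // mulr_ge0 // ltW.
Qed.

End Growth.

Section ExcessProbability.
Local Open Scope ereal_scope.
Variables (R : realType) (h : probability nat R) (nu : probability (measurableTypeR R) R).
Hypothesis nu_gt1 : nu `]1%R, +oo[%classic = 1.

Lemma tree_tail_ge0 t u : 0 <= tree_tail nu t u.
Proof. exact: measure_ge0. Qed.

Lemma le_tree_tail_prune g i t u : (i < depth t)%N -> (0 <= u)%R ->
  tree_tail nu t u <= (outgrowth_size i t)%:R%:E *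
    tree_tail nu (prune g i t) (u / (outgrowth_size i t)%:R).
Proof.
move=> it u0.
apply: (@le_tree_tail_embedding _ _ nu_gt1 t (kept t i) _ _ _ _ (relabel t i) (vbase t)) => //.
- exact: kept_uniq.
- exact: kept_sub.
- by move=> v j; exact: kept_take.
- exact: relabel_prune.
- exact: relabel_inj.
- by move=> v _; exact: size_relabel.
- exact: relabel_take.
- exact: vbase_kept.
- by move=> v; rewrite size_vbase; exact: leq_depth.
- exact: count_notin_kept.
Qed.

Lemma le_tree_tail t (u v : R) : (u <= v)%R -> tree_tail nu t v <= tree_tail nu t u.
Proof.
move=> uv; apply: le_measure; rewrite ?inE.
- exact: measurable_gt_sum_vweight.
- exact: measurable_gt_sum_vweight.
- by move=> b /=; exact: le_lt_trans.
Qed.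

Definition gw_tail (u : R) : \bar R :=
  \esum_(t in [set: rtree]) ((gw_mass h t)%:E * tree_tail nu t u).

Lemma gw_tailE u : gw_law h nu [set T | (u < tweight T)%R] = gw_tail u.
Proof. by []. Qed.

Lemma gw_tail_ge0 u : 0 <= gw_tail u.
Proof. by apply: esum_ge0 => t _; rewrite mule_ge0 ?lee_fin ?gw_mass_ge0 ?tree_tail_ge0. Qed.

Lemma le_gw_tail (u v : R) : (u <= v)%R -> gw_tail v <= gw_tail u.
Proof.
by move=> uv; apply: le_esum => t _; rewrite lee_wpmul2l ?lee_fin ?gw_mass_ge0 ?le_tree_tail.
Qed.

(** Planting is injective and has a cost that does not depend on the tree. *)
Lemma gw_tail_div g (rho u : R) : (0 < rho)%R ->
  (offspring h g.+1 * offspring h 0 ^+ g * fine (nu `[rho, +oo[%classic))%:E * gw_tail (u / rho)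
  <= gw_tail u.
Proof.
move=> rho0; set beta := fine _.
have betaE : nu `[rho, +oo[%classic = beta%:E by rewrite /beta fineK // fin_num_measure.
have beta0 : (0 <= beta)%R by apply: fine_ge0.
have D0 : (0 <= offspring h g.+1 * offspring h 0 ^+ g)%R.
  by rewrite mulr_ge0 ?exprn_ge0 ?offspring_ge0.
have term0 t v : 0 <= (gw_mass h t)%:E * tree_tail nu t v.
  by rewrite mule_ge0 ?lee_fin ?gw_mass_ge0 ?tree_tail_ge0.
rewrite /gw_tail -esumZl ?(mulr_ge0 D0 beta0) //.
apply: le_trans (esum_inj_le (@plant_inj g) (fun t => term0 t u)).
apply: le_esum => t _; rewrite gw_mass_plant.
have le_plant : beta%:E * tree_tail nu t (u / rho) <= tree_tail nu (plant g t) u.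
  by rewrite -betaE; apply: le_tree_tail_graft => // v vt; rewrite mem_node_cons.
have m0 : 0 <= (offspring h g.+1 * offspring h 0 ^+ g * gw_mass h t)%:E.
  by rewrite lee_fin mulr_ge0 ?gw_mass_ge0.
apply: le_trans (lee_wpmul2l m0 le_plant).
by rewrite !muleA -!EFinM mulrAC.
Qed.

Lemma gw_tail_div_expn (D rho u : R) m : (0 < D)%R ->
  (forall u, D%:E * gw_tail (u / rho) <= gw_tail u) ->
  gw_tail (u / rho ^+ m) <= (D^-1 ^+ m)%:E * gw_tail u.
Proof.
move=> D0 De; elim: m u => [|m IH] u; first by rewrite expr0 divr1 mul1e.
rewrite exprSr invfM mulrA.
have Dm0 : 0 <= (D^-1)%:E by rewrite lee_fin invr_ge0 ltW.
have := lee_wpmul2l Dm0 (De (u / rho ^+ m)%R).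
rewrite muleA -EFinM mulVf ?gt_eqF // mul1e => /le_trans; apply.
by rewrite exprS EFinM -muleA lee_wpmul2l.
Qed.

Lemma gw_tail_div_subexp g (rho eta : R) :
  (0 < offspring h g.+1)%R -> (0 < offspring h 0)%R -> (1 < rho)%R ->
  0 < nu `[rho, +oo[%classic -> (0 < eta)%R ->
  exists2 C : R, (0 < C)%R & forall u n, (0 <= u)%R -> (0 < n)%N ->
    gw_tail (u / n%:R) <= (C * expR (eta * n%:R))%:E * gw_tail u.
Proof.
move=> pg p0 rho1 nurho eta0.
pose D := (offspring h g.+1 * offspring h 0 ^+ g * fine (nu `[rho, +oo[%classic))%R.
have D0 : (0 < D)%R.
  apply: mulr_gt0; first by apply: mulr_gt0 => //; exact: exprn_gt0.
  by rewrite fine_gt0 // nurho ltey_eq fin_num_measure.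
have B1 : (1 <= 1 + D^-1)%R by rewrite lerDl invr_ge0 ltW.
have [C0 C00 C0P] := subexponential_growth rho1 B1 eta0.
have rho0 : (0 < rho)%R by apply: lt_trans rho1.
exists C0 => // u n u0 n0; have [m [nm Bm]] := C0P n.
apply: (@le_trans _ _ (gw_tail (u / rho ^+ m))).
  by apply: le_gw_tail; rewrite ler_wpM2l // lef_pV2 ?posrE ?exprn_gt0 ?ltr0n.
apply: (le_trans (gw_tail_div_expn _ _ D0 (fun u => gw_tail_div g u rho0))).
apply: lee_wpmul2r; first exact: gw_tail_ge0.
rewrite lee_fin; apply: le_trans Bm; apply: lerXn2r; rewrite ?nnegrE.
- by rewrite invr_ge0 ltW.
- by rewrite addr_ge0 // invr_ge0 ltW.
- by rewrite lerDr.
Qed.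

(** * Exponential decay of the outgrowths *)

(** If no positive number of children has positive probability, then trees of
    positive depth have mass 0.  Otherwise, for each n, the weight and the
    probability estimates give a bound n K e^{-cn} C0 e^{eta n}, and with
    eta = c / 4 this is at most C1 q^n q^n for q = e^{-eta}: one factor q^n
    yields the decay in k, the other one makes the sum over n >= k converge. *)
Lemma gw_tail_large_outgrowth :
  \esum_(r in [set: nat]) (r%:R * offspring h r)%:E < 1 ->
  (exists2 a : R, (0 < a)%R & forall r, (offspring h r <= expR (- (a * r%:R)))%R) ->
  (exists2 rho : R, (1 < rho)%R & 0 < nu `[rho, +oo[%classic) ->
  exists c C : R, [/\ (0 < c)%R, (0 < C)%R &
    forall (u : R) (i k : nat), (0 <= u)%R ->
    \esum_(t in [set t | (i < depth t)%N && (k <= outgrowth_size i t)%N])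
        ((gw_mass h t)%:E * tree_tail nu t u)
      <= (C * expR (- (c * k%:R)))%:E * gw_tail u].
Proof.
move=> mean [a a0 pa] [rho rho1 nurho].
have [[g pg]|nog] := pselect (exists g, offspring h g.+1 != 0%R); last first.
  exists 1%R, 1%R; split => // u i k _.
  rewrite esum1; first by rewrite mule_ge0 ?gw_tail_ge0 // lee_fin mul1r expR_ge0.
  move=> t /= /andP[it _]; rewrite -(kidsK t) gw_mass_node.
  have := kids_neq0 (leq_ltn_trans (leq0n _) it).
  case: (kids t) => // x l _ /=.
  have [->|pl] := eqVneq (offspring h (size l).+1) 0%R; first by rewrite mul0r mul0e.
  by case: nog; exists (size l).
have {}pg : (0 < offspring h g.+1)%R by rewrite lt_neqAle eq_sym pg offspring_ge0.
have p0 := offspring0_gt0 mean.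
have [lam [c [/andP[lam0 lam1] c0 mom]]] :=
  subcritical_exponent a0 (offspring_ge0 h) (esum_offspring h) mean pa.
pose z := expR c; pose s := expR lam; pose b := expR (- a).
have z0 : (0 < z)%R by exact: expR_gt0.
have b0 : (0 <= b)%R by exact: expR_ge0.
have bs : (b * s < 1)%R by rewrite -expRD expR_lt1; lra.
have pb r : (offspring h r.+1 <= b ^+ r)%R.
  apply: (le_trans (pa r.+1)); rewrite /b -expRM_natr ler_expR mulNr lerN2.
  by rewrite ler_wpM2l ?(ltW a0) // ler_nat.
have moment : \esum_(t in [set: rtree]) (gw_mass h t * z ^+ #|` tree_fset t|)%:E <= s%:E.
  apply: esum_card_moment; rewrite ?expR_ge0 //.
  under eq_esum do rewrite -mulrA EFinM.
  rewrite esumZl ?expR_ge0 //; last first.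
    by move=> r _; rewrite lee_fin mulr_ge0 ?offspring_ge0 ?exprn_ge0 ?expR_ge0.
  apply: le_trans (lee_wpmul2l (ltW z0 : 0 <= z%:E) mom) _.
  by rewrite -EFinM lee_fin /z /s -expRD subrKC.
pose K := prune_const h g z s b.
have K0 : (0 <= K)%R by apply: prune_const_ge0.
pose eta := (c / 4)%R.
have eta0 : (0 < eta)%R by rewrite divr_gt0.
have [C0 C00 gw_tail_n] := gw_tail_div_subexp pg p0 rho1 nurho eta0.
pose q := expR (- eta).
have q01 : (0 <= q < 1)%R by rewrite expR_ge0 expR_lt1 oppr_lt0.
pose C1 := (K * C0 / eta)%R.
have C10 : (0 <= C1)%R.
  by apply: divr_ge0 (ltW eta0); apply: mulr_ge0 K0 (ltW C00).
have qn_ge0 n : (0 <= q ^+ n)%R by rewrite exprn_ge0 ?expR_ge0.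
have Cq0 m n : (0 <= C1 * q ^+ m * q ^+ n)%R.
  exact: mulr_ge0 (mulr_ge0 C10 (qn_ge0 _)) (qn_ge0 _).
have term0 t v : 0 <= (gw_mass h t)%:E * tree_tail nu t v.
  by rewrite mule_ge0 ?lee_fin ?gw_mass_ge0 ?tree_tail_ge0.
(* the contribution of the outgrowths of size n *)
have fixed_size u i n : (0 <= u)%R ->
    \esum_(t in [set t | (i < depth t)%N && (outgrowth_size i t == n)])
      ((gw_mass h t)%:E * tree_tail nu t u)
    <= (C1 * q ^+ n * q ^+ n)%:E * gw_tail u.
  move=> u0; have [->|n0] := posnP n.
    rewrite esum1; first by rewrite mule_ge0 ?gw_tail_ge0 // lee_fin Cq0.
    move=> t /= /andP[it /eqP t0]; apply/eqP; rewrite mule_eq0; apply/orP; right.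
    rewrite eq_le tree_tail_ge0 andbT; apply: le_trans (le_tree_tail_prune g it u0) _.
    by rewrite t0 mul0e.
  pose H t := (gw_mass h t * z ^+ outgrowth_size i t)%:E * tree_tail nu (prune g i t) (u / n%:R).
  have H0 t : 0 <= H t.
    by rewrite mule_ge0 ?tree_tail_ge0 // lee_fin mulr_ge0 ?gw_mass_ge0 ?exprn_ge0 ?expR_ge0.
  have nz0 : (0 <= n%:R * z ^- n)%R by rewrite mulr_ge0 // invr_ge0 exprn_ge0 ?expR_ge0.
  apply: (@le_trans _ _ (\esum_(t in [set t | (i < depth t)%N]) ((n%:R * z ^- n)%:E * H t))).
    rewrite esum_mkcond [leRHS]esum_mkcond; apply: le_esum => t _.
    case: ifPn => [|_]; last by case: ifP => // _; rewrite mule_ge0 // lee_fin.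
    rewrite inE /= => /andP[it /eqP tn]; rewrite mem_set //= /H tn.
    have m0 : 0 <= (gw_mass h t)%:E by rewrite lee_fin gw_mass_ge0.
    apply: (le_trans (lee_wpmul2l m0 (le_tree_tail_prune g it u0))).
    rewrite tn !muleA -!EFinM le_eqVlt; apply/orP; left; apply/eqP; congr (_%:E * _).
    have : (z ^- n * z ^+ n = 1)%R by rewrite mulVf // expf_neq0 // gt_eqF.
    move: (z ^- n)%R => x; move: (z ^+ n)%R => y xy.
    by transitivity (gw_mass h t * n%:R * (x * y))%R; [rewrite xy mulr1|ring].
  rewrite esumZl //.
  have nz0' : 0 <= (n%:R * z ^- n)%:E by rewrite lee_fin.
  have := esum_prune z0 b0 p0 pg pb bs moment i (fun t => tree_tail_ge0 t (u / n%:R)).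
  move=> /(lee_wpmul2l nz0') /le_trans; apply.
  rewrite -/K -/(gw_tail _).
  have K0' : 0 <= K%:E by rewrite lee_fin.
  apply: (le_trans (lee_wpmul2l nz0' (lee_wpmul2l K0' (gw_tail_n u n u0 n0)))).
  rewrite !muleA -!EFinM; apply: lee_wpmul2r; first exact: gw_tail_ge0.
  rewrite lee_fin /C1.
  have n_le : (n%:R <= eta^-1 * expR (eta * n%:R))%R.
    rewrite -ler_pdivrMl ?invr_gt0 // invrK.
    by apply: le_trans (expR_ge1Dx _); rewrite lerDr.
  have -> : (z ^- n = q ^+ n * q ^+ n * q ^+ n * q ^+ n)%R.
    rewrite /z /q -!expRM_natr -expRN -!expRD; by congr expR; rewrite /eta; field.
  set w := expR (eta * n%:R); have qw : (q ^+ n * w = 1)%R.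
    by rewrite /q /w -expRM_natr -expRD mulNr addNr expR0.
  have qn0 := qn_ge0 n.
  apply: (@le_trans _ _ (eta^-1 * w * (q ^+ n * q ^+ n * q ^+ n * q ^+ n) * K * (C0 * w))%R).
    apply: ler_wpM2r; first by rewrite mulr_ge0 ?expR_ge0 // ltW.
    apply: ler_wpM2r => //; apply: ler_wpM2r => //.
    by rewrite !mulr_ge0.
  rewrite le_eqVlt; apply/orP; left; apply/eqP.
  transitivity (K * C0 / eta * q ^+ n * q ^+ n * ((q ^+ n * w) * (q ^+ n * w)))%R; first by ring.
  by rewrite qw !mulr1.
exists eta, (1 + C1 * (1 - q)^-1)%R; split => //.
  rewrite ltr_pwDl // mulr_ge0 // invr_ge0 subr_ge0 ltW //.
  by case/andP: q01.
move=> u i k u0.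
rewrite esum_mkcond (esum_partition (outgrowth_size i)); last by move=> t; case: ifP.
apply: (@le_trans _ _ (\esum_(n in [set: nat]) ((C1 * q ^+ k * q ^+ n)%:E * gw_tail u))).
  apply: le_esum => n _; have [kn|nk] := leqP k n; last first.
    rewrite esum1; first by rewrite mule_ge0 ?gw_tail_ge0 // lee_fin Cq0.
    move=> t /= tn; rewrite ifN //; apply/negP; rewrite inE /= tn => /andP[_].
    by rewrite leqNgt nk.
  apply: (@le_trans _ _ ((C1 * q ^+ n * q ^+ n)%:E * gw_tail u)); last first.
    apply: lee_wpmul2r; first exact: gw_tail_ge0.
    rewrite lee_fin ler_wpM2r ?exprn_ge0 ?expR_ge0 // ler_wpM2l //.
    by rewrite ler_wiXn2l // ?expR_ge0 // ltW //; case/andP: q01.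
  apply: le_trans (fixed_size u i n u0); rewrite esum_mkcond [leRHS]esum_mkcond.
  apply: le_esum => t _; case: ifPn => [|_]; last by case: ifP.
  rewrite inE /= => tn; case: ifPn => [|_]; last by case: ifP.
  by rewrite inE /= => /andP[it _]; rewrite mem_set //= it tn eqxx.
apply: le_trans (esumZr_le _ (gw_tail_ge0 u)) _.
  by move=> n _; rewrite lee_fin Cq0.
apply: lee_wpmul2r; first exact: gw_tail_ge0.
under eq_esum do rewrite EFinM.
rewrite esumZl; last 2 first.
- exact: mulr_ge0 C10 (qn_ge0 k).
- by move=> n _; rewrite lee_fin exprn_ge0 ?expR_ge0.
have Ck0 : 0 <= (C1 * q ^+ k)%:E by rewrite lee_fin; exact: mulr_ge0 C10 (qn_ge0 k).
apply: le_trans (lee_wpmul2l Ck0 (esum_geometric q01)) _.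
rewrite -EFinM lee_fin /q -expRM_natr mulNr mulrAC ler_wpM2r ?expR_ge0 //.
by rewrite lerDr.
Qed.

Lemma gw_law_outgrowth (u : R) i k :
  gw_law h nu ([set T | (k <= #|` outgrowth (wt_tree T) i|)%N] `&` [set T | (u < tweight T)%R]) =
  \esum_(t in [set t | (k <= #|` outgrowth t i|)%N]) ((gw_mass h t)%:E * tree_tail nu t u).
Proof.
rewrite esum_mkcond; apply: eq_esum => t _; rewrite preimage_setI.
have [kt|tk] := leqP k #|` outgrowth t i|.
  rewrite mem_set //=; congr (_ * _); rewrite /tree_tail; congr (iid _ _ _).
  by apply/seteqP; split=> b //= -[].
rewrite ifN; last by apply/negP; rewrite inE /= leqNgt tk.
rewrite (_ : _ `&` _ = set0) ?measure0 ?mule0 //.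
by apply/seteqP; split=> b //= -[]; rewrite leqNgt tk.
Qed.

End ExcessProbability.

(** A vanishing denominator forces a vanishing numerator, and division by an
    infinite one gives 0. *)
Lemma ediv_le (R : realType) (x : R) (n d : \bar R) :
  0 <= x -> (0 <= n -> 0 <= d -> n <= x%:E * d -> n / d <= x%:E)%E.
Proof.
move=> x0 n0; case: d => [d| |] // d0 nd; last by rewrite invey mule0 lee_fin.
have [d00|dn0] := eqVneq d 0.
  suff -> : n = 0%E by rewrite mul0e lee_fin.
  by apply/eqP; rewrite eq_le n0 andbT; move: nd; rewrite d00 mule0.
rewrite inver (negbTE dn0) lee_pdivrMr //.
by rewrite lt_neqAle eq_sym dn0 -lee_fin.
Qed.

Unset Implicit Arguments.

Theorem theorem6 (R : realType)
    (h : probability nat R) (nu : probability (measurableTypeR R) R)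
    (h_mean : (\sum_(1 <= k <oo) k%:R%:E * h [set k] < 1)%E)
    (h_tail : exists a : R, 0 < a /\ forall k : nat, (1 <= k)%N ->
       (\sum_(k <= l <oo) h [set l] <= (expR (- (a * k%:R)))%:E)%E)
    (nu_compact : compact (msupport nu))
    (nu_gt1 : msupport nu `<=` `]1, +oo[) :
  exists c C : R, 0 < c /\ 0 < C /\
    forall (u : R) (i : nat), 0 < u ->
    forall k : nat, (1 <= k)%N ->
      (gw_cond h nu u [set T | (k <= #|` outgrowth (wt_tree T) i|)%N]
        <= (C * expR (- (c * k%:R)))%:E)%E.
Proof.
have nu1 := nu_itv1 nu_gt1.
have mean := esum_offspring_mean h_mean.
have tail_h : exists2 a : R, 0 < a & forall r, offspring h r <= expR (- (a * r%:R)).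
  by have [a [a0 ha]] := h_tail; exists a => //; exact: offspring_le_exp.
have [c [C [c0 C0 cC]]] := gw_tail_large_outgrowth nu1 mean tail_h (nu_rho nu_gt1).
exists c, (C + expR c); split => //; split; first by rewrite addr_gt0 ?expR_gt0.
move=> u i u0 k k1; rewrite /gw_cond.
have x0 : 0 <= (C + expR c) * expR (- (c * k%:R)) by rewrite mulr_ge0 ?addr_ge0 ?expR_ge0 ?ltW.
apply: ediv_le => //.
rewrite gw_law_outgrowth gw_tailE.
have term0 t : (0 <= (gw_mass h t)%:E * tree_tail nu t u)%E.
  by rewrite mule_ge0 ?lee_fin ?gw_mass_ge0 ?tree_tail_ge0.
(* For k = 1 the probability is bounded by 1, which also covers the indices i
   at which the outgrowth has at most one vertex. *)
have [k2|k2] := leqP 2 k; last first.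
  have -> : k = 1%N by apply/eqP; rewrite eqn_leq k1 -ltnS k2.
  apply: (@le_trans _ _ (gw_tail h nu u)); first exact: subset_esum.
  rewrite -[leLHS]mul1e; apply: lee_wpmul2r; first exact: gw_tail_ge0.
  by rewrite lee_fin mulr1 mulrDl -expRD subrr expR0 lerDr mulr_ge0 ?expR_ge0 ?ltW.
apply: le_trans (le_trans _ (cC u i k (ltW u0))) _; last first.
  apply: lee_wpmul2r; first exact: gw_tail_ge0.
  by rewrite lee_fin ler_wpM2r ?expR_ge0 // lerDl expR_ge0.
apply: subset_esum => // t /= kt.
have it : (i < depth t)%N.
  rewrite ltnNge; apply/negP => /card_outgrowth_end; apply/negP; rewrite -ltnNge.
  exact: leq_trans kt.
by rewrite it (leq_trans kt) // (leq_trans (card_outgrowth_le t i)) // count_hangs_le.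
Qed.
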